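(* Let $X_1,X_2,\ldots$ be the limit age-ordered frequencies generated by an exchangeable Gibbs partition EGP$(\alpha,V)$, and let $W_m=\sum_{i=1}^mX_i$. For every $m=1,2,\ldots$ and every nonnegative integer $n$, $$\mathbb{E}(W_m^n\mid i_m)=(i_m-\alpha m)_{(n)}\,\frac{V_{i_m+n,m}}{V_{i_m,m}}$$ and $$\mathbb{E}(X_m^n\mid i_m)=(1-\alpha)_{(n)}\,\frac{V_{i_m+n,m}}{V_{i_m,m}},$$ where $i_m$ is the $m$-th record index of the partition.
   Context: Notation: $a_{(x)}=\Gamma(a+x)/\Gamma(a)$; for integers $r\ge1$, $a_{(r)}=a(a+1)\cdots(a+r-1)$, and $a_{(0)}=1$. A random partition of $[n]=\{1,\ldots,n\}$ is written $\Pi_n=(\Pi_{n1},\ldots,\Pi_{nk})$ with classes ordered by their least elements. For a consistent family $\Pi=(\Pi_n)$ (a random partition of $\mathbb{N}$), the record indices $1=i_1<i_2<\cdots$ are the least elements of its classes, and the limit age-ordered frequencies are $X_j=\lim_{n\to\infty}|\Pi_{nj}|/n$. Conditional statements given $i_m$ are for finite values of $i_m$ taken with positive probability. Let $\alpha\in(-\infty,1]$ and let $V=(V_{n,k}:1\le k\le n)$ be nonnegative coefficients with $V_{1,1}=1$ and $V_{n,k}=(n-\alpha k)V_{n+1,k}+V_{n+1,k+1}$. The exchangeable Gibbs partition EGP$(\alpha,V)$ is the random partition $\Pi=(\Pi_n)$ of $\mathbb{N}$ generated by: $\Pi_1=(\{1\})$; for $n\ge1$, given $\Pi_n=(\pi_{n1},\ldots,\pi_{nk})$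 with class sizes $n_j=|\pi_{nj}|$, the element $n+1$ starts a new class with probability $V_{n+1,k+1}/V_{n,k}$, and joins the class $\pi_{nj}$ with probability $\frac{n_j-\alpha}{n-\alpha k}\left(1-\frac{V_{n+1,k+1}}{V_{n,k}}\right)$, $j=1,\ldots,k$ (read as $0$ when $n-\alpha k=0$). *)

(* Defs.v *)
(* MathComp + MathComp-Analysis *)
From HB Require Import structures.
From mathcomp Require Import all_boot all_order all_algebra finmap.
From mathcomp Require Import all_classical all_reals all_analysis.

Set Implicit Arguments.
Unset Strict Implicit.
Unset Printing Implicit Defensive.

Import Order.TTheory GRing.Theory Num.Theory.
Import numFieldNormedType.Exports.

Local Open Scope classical_set_scope.
Local Open Scope ring_scope.

(* a_(r) = a (a + 1) ... (a + r - 1) *)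
Definition rising (R : realType) (a : R) (r : nat) : R :=
  \prod_(i < r) (a + i%:R).

(* V is indexed by all of nat * nat; only its entries with 1 <= k <= n matter. *)
Definition gibbs_coefficients (R : realType) (alpha : R) (V : nat -> nat -> R)
    : Prop :=
  [/\ forall n k, (0 < k <= n)%N -> 0 <= V n k,
      V 1%N 1%N = 1 &
      forall n k, (0 < k <= n)%N ->
        V n k = (n%:R - alpha * k%:R) * V n.+1 k + V n.+1 k.+1].

Definition integers_upto (n : nat) : {fset nat} := [fset i in iota 1 n]%fset.

(* 0 if A is empty *)
Definition least (A : {fset nat}) : nat := head 0%N (sort leq A).

(* s lists the classes of a partition of {1, ..., n} by increasing least
   element. *)
Definition ordered_partition (n : nat) (s : seq {fset nat}) : bool :=
  [&& fset0 \notin s,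
      pairwise (fun A B : {fset nat} => fdisjoint A B) s,
      (\bigcup_(A <- s) A == integers_upto n)%fset &
      sorted ltn [seq least A | A <- s]].

Definition restrict_partition (n : nat) (s : seq {fset nat})
    : seq {fset nat} :=
  [seq B <- [seq (A `&` integers_upto n)%fset | A <- s] | B != fset0].

(* Classes are numbered from 1; there is no class beyond the size s-th, and
   nth_class returns the empty set there. *)
Definition nth_class (s : seq {fset nat}) (j : nat) : {fset nat} :=
  nth fset0 s j.-1.

Definition new_class (s : seq {fset nat}) (x : nat) : seq {fset nat} :=
  rcons s [fset x]%fset.

Definition join_class (s : seq {fset nat}) (j x : nat) : seq {fset nat} :=
  set_nth fset0 s j.-1 (x |` nth_class s j)%fset.

Local Open Scope ereal_scope.

Definition cond_prob d (T : measurableType d) (R : realType)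
    (P : probability T R) (A B : set T) : \bar R := P (A `&` B) / P B.

Definition cond_expectation d (T : measurableType d) (R : realType)
    (P : probability T R) (X : T -> R) (B : set T) : \bar R :=
  (\int[P]_(w in B) (X w)%:E) / P B.

Local Close Scope ereal_scope.

(* Pi n is the random partition of {1, ..., n}. *)
Record random_partition d (T : measurableType d)
    (Pi : nat -> T -> seq {fset nat}) : Prop := RandomPartition {
  rp_measurable : forall n s, measurable [set w | Pi n w = s];
  rp_partition : forall n w, ordered_partition n (Pi n w);
  rp_consistent : forall n w, Pi n w = restrict_partition n (Pi n.+1 w) }.

(* Pi_1 = ({1}) holds by rp_partition. Pi_n determines Pi_1, ..., Pi_(n-1), so
   conditioning on Pi_n is conditioning on the whole past. Division by zero is
   zero in R, so the joining probability is 0 when n - alpha k = 0. *)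
Record EGP d (T : measurableType d) (R : realType) (P : probability T R)
    (alpha : R) (V : nat -> nat -> R) (Pi : nat -> T -> seq {fset nat})
    : Prop := IsEGP {
  egp_partition : random_partition Pi;
  egp_new : forall n s, (0 < n)%N ->
    (0 < P [set w | Pi n w = s])%E ->
    cond_prob P [set w | Pi n.+1 w = new_class s n.+1] [set w | Pi n w = s]
    = (V n.+1 (size s).+1 / V n (size s))%:E;
  egp_join : forall n s j, (0 < n)%N ->
    (0 < P [set w | Pi n w = s])%E ->
    (0 < j <= size s)%N ->
    cond_prob P [set w | Pi n.+1 w = join_class s j n.+1] [set w | Pi n w = s]
    = (((#|` nth_class s j|)%:R - alpha) / (n%:R - alpha * (size s)%:R)
       * (1 - V n.+1 (size s).+1 / V n (size s)))%:E }.

(* The j-th class of the partition of {1, 2, ...}, empty if there are fewer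
   than j classes. *)
Definition limit_class (T : Type) (Pi : nat -> T -> seq {fset nat}) (j : nat)
    (w : T) : set nat := \bigcup_n [set` nth_class (Pi n w) j].

(* The event i_m = i. On the complement of the union of these events over i,
   there are fewer than m classes and i_m is infinite. *)
Definition record_index_event (T : Type) (Pi : nat -> T -> seq {fset nat})
    (m i : nat) : set T :=
  [set w | limit_class Pi m w i
           /\ forall l, limit_class Pi m w l -> (i <= l)%N].

(* X_j; for an EGP the limit exists almost surely, and off that event limn
   returns the default value 0. *)
Definition frequency (R : realType) (T : Type)
    (Pi : nat -> T -> seq {fset nat}) (j : nat) (w : T) : R :=
  limn (fun n => (#|` nth_class (Pi n w) j|)%:R / n%:R : R).

Definition cumulative_frequency (R : realType) (T : Type)
    (Pi : nat -> T -> seq {fset nat}) (m : nat) (w : T) : R :=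
  \sum_(1 <= j < m.+1) frequency R Pi j w.

(* Main.v *)
(* P(Pi_n = s) is V_{n,k} times a product of rising factorials of 1 - alpha, one
   for each class of s. Fix a state s at time n and a set J of its first m
   classes, and let D_L count the elements among n + 1, ..., n + L that join J.
   The probability that n + 1, ..., n + a all join J is
   q_a = rising Y a * V_{n+a,k} / V_{n,k}, where Y is the number of elements in J
   minus alpha |J|; these probabilities form a martingale as s evolves, so by
   induction on L the a-th falling factorial moment of D_L is that of L times
   q_a. The second moments give E (D_L/L - D_M/M)^2 = (q_1 - q_2) (1/L - 1/M).
   Along the cubes L = k^3 this is summable against the weights k (k + 1), which
   forces almost sure convergence; monotonicity of D_L fills the gaps between
   consecutive cubes, and dominated convergence gives E X_J^a = q_a.
   Finally i_m = i means that Pi_i has exactly m classes, the last being {i}; in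
   all these states Y has the same value, i - alpha m when J consists of the
   first m classes and 1 - alpha when J is the m-th class alone. *)

Require Import Defs.
From HB Require Import structures.
From mathcomp Require Import all_boot all_order all_algebra finmap.
From mathcomp Require Import all_classical all_reals all_analysis.
From mathcomp Require Import measurable_realfun.
From mathcomp Require Import zify ring lra.

Set Implicit Arguments.
Unset Strict Implicit.
Unset Printing Implicit Defensive.

Import Order.TTheory GRing.Theory Num.Theory.
Import numFieldNormedType.Exports.

Local Open Scope classical_set_scope.
Local Open Scope ring_scope.

(** * One-step extensions of ordered partitions *)

Section OrderedPartitions.

Implicit Types (s c : seq {fset nat}) (A B : {fset nat}).

Lemma nth_class_succ s j : nth_class s j.+1 = nth fset0 s j.
Proof. by []. Qed.

Lemma integers_uptoE n x : (x \in integers_upto n) = (0 < x <= n)%N.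
Proof. by rewrite inE /= mem_iota; lia. Qed.

Lemma mem_least A : A != fset0 -> least A \in A.
Proof.
move=> A0; rewrite /least.
have : size (sort leq A) != 0%N by rewrite size_sort cardfs_eq0.
case E: (sort leq A) => [//|x r] _ /=.
by rewrite -(mem_sort leq) E mem_head.
Qed.

(** The candidates for [Pi n.+1] given [Pi n = s]. The indices from [iota] start at 0, whereas
    [join_class] numbers classes from 1, hence [j.+1]. *)
Definition children n s : seq (seq {fset nat}) :=
  new_class s n.+1 :: [seq join_class s j.+1 n.+1 | j <- iota 0 (size s)].

Lemma join_class_cat (s1 s2 : seq {fset nat}) A x :
  join_class (s1 ++ A :: s2) (size s1).+1 x = s1 ++ (x |` A)%fset :: s2.
Proof.
rewrite /join_class nth_class_succ nth_cat ltnn subnn /=.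
by elim: s1 => //= B s1 ->.
Qed.

Lemma restrict_cat n (s1 s2 : seq {fset nat}) :
  restrict_partition n (s1 ++ s2)
  = restrict_partition n s1 ++ restrict_partition n s2.
Proof. by rewrite /restrict_partition map_cat filter_cat. Qed.

Lemma restrict_id n s : fset0 \notin s ->
  {in s, forall A, A `<=` integers_upto n}%fset -> restrict_partition n s = s.
Proof.
elim: s => //= A s IH; rewrite inE negb_or => /andP[A0 s0] sn.
rewrite /restrict_partition /= -/(restrict_partition n s) IH //.
  by rewrite (fsetIidPl _) ?sn ?mem_head// eq_sym A0.
by move=> B Bs; apply: sn; rewrite inE Bs orbT.
Qed.

(** Exactly one class A contains [n.+1], and restriction leaves the other classes alone. If A has
    another element, s arises by a join; otherwise A is a singleton, and the order by least elements
    forces it to the end of the list. *)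
Lemma ordered_partition_children n s : ordered_partition n.+1 s ->
  s \in children n (restrict_partition n s).
Proof.
case/and4P => s0 dis /eqP cov srt.
have : n.+1 \in (\bigcup_(A <- s) A)%fset by rewrite cov integers_uptoE; lia.
move=> /bigfcupP[A /andP[As _] nA].
have ub B x : B \in s -> x \in B -> (0 < x <= n.+1)%N.
  move=> Bs xB; rewrite -integers_uptoE -cov; apply/bigfcupP; exists B => //.
  by rewrite Bs.
case/splitPr: As s0 dis srt ub {cov} => s1 s2 s0 dis srt ub.
have disA B : B \in s1 ++ s2 -> n.+1 \notin B.
  move: dis; rewrite pairwise_cat /= allrel_consr => /and3P[/andP[d1 _] _ /andP[d2 _]].
  rewrite mem_cat => /orP[Bs|Bs].
    by move/allP: d1 => /(_ _ Bs) /fdisjointP H; apply/negP => /H; rewrite nA.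
  by move/allP: d2 => /(_ _ Bs) /fdisjointP /(_ _ nA).
have sub B : B \in s1 ++ s2 -> (B `<=` integers_upto n)%fset.
  move=> Bs; apply/fsubsetP => x xB; rewrite integers_uptoE.
  have xn : x != n.+1 by apply: contraNneq (disA _ Bs) => <-.
  have := ub B x; rewrite mem_cat inE => /(_ _ xB) H.
  suff: (0 < x <= n.+1)%N by lia.
  by apply: H; move: Bs; rewrite mem_cat => /orP[] ->; rewrite ?orbT.
have s10 : fset0 \notin s1 by move: s0; rewrite mem_cat negb_or => /andP[].
have s20 : fset0 \notin s2.
  by move: s0; rewrite mem_cat negb_or inE negb_or => /andP[_ /andP[]].
have r1 : restrict_partition n s1 = s1.
  by apply: restrict_id => // B Bs; apply: sub; rewrite mem_cat Bs.
have r2 : restrict_partition n s2 = s2.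
  by apply: restrict_id => // B Bs; apply: sub; rewrite mem_cat Bs orbT.
have An : (n.+1 |` (A `&` integers_upto n))%fset = A.
  apply/fsetP => x; rewrite !inE /= mem_iota; case: eqVneq => [->//|xn] /=.
  case xA: (x \in A) => //=; have := ub A x; rewrite mem_cat mem_head orbT xA.
  by move=> /(_ isT isT); lia.
rewrite -cat1s restrict_cat (restrict_cat _ [:: A]) r1 r2 /restrict_partition /=.
have [A0|A0] := eqVneq (A `&` integers_upto n)%fset fset0; rewrite /= inE.
  have {}An : A = [fset n.+1]%fset by rewrite -An A0 fsetU0.
  (* A class after A would have a least element above [n.+1], yet all other classes lie in {1, ...,
     n}. *)
  suff -> : s2 = [::] by rewrite cats0 cats1 /new_class An eqxx.
  case: s2 srt sub ub s20 {r2 dis disA s0} => // B s2 srt sub ub s20.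
  have lB : (least A < least B)%N.
    by move: srt; rewrite map_cat /= sorted_cat_cons => /andP[_ /= /andP[]].
  have : (least B <= n)%N.
    have B0 : B != fset0 by move: s20; rewrite inE negb_or eq_sym => /andP[].
    have BB := mem_least B0.
    have /fsubsetP /(_ _ BB) : (B `<=` integers_upto n)%fset.
      by apply: sub; rewrite mem_cat mem_head orbT.
    by rewrite integers_uptoE => /andP[].
  have : least A \in A by apply: mem_least; apply/fset0Pn; exists n.+1; rewrite nA.
  by rewrite An inE => /eqP; move: lB; rewrite An; lia.
apply/orP; right; apply/mapP; exists (size s1).
  by rewrite mem_iota size_cat /=; lia.
by rewrite /= join_class_cat An.
Qed.

(** Carries the history of a state, so that sizes, sums and probabilities can be treated by
    induction on arrivals. States of probability zero are included. *)
Inductive reachable : nat -> seq {fset nat} -> Prop :=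
| reachable_nil : reachable 0 [::]
| reachable_child n s c :
    reachable n s -> c \in children n s -> reachable n.+1 c.

Lemma childrenP n s c :
  c \in children n s ->
  c = new_class s n.+1 \/
  exists2 j, (j < size s)%N & c = join_class s j.+1 n.+1.
Proof.
rewrite inE => /orP[/eqP ->|/mapP[j]]; first by left.
by rewrite mem_iota /= => js ->; right; exists j.
Qed.

Lemma join_classE s j x : (j < size s)%N ->
  join_class s j.+1 x
  = take j s ++ (x |` nth fset0 s j)%fset :: drop j.+1 s.
Proof. by move=> js; rewrite /join_class nth_class_succ set_nthE js. Qed.

Lemma split_nth s j : (j < size s)%N ->
  s = take j s ++ nth fset0 s j :: drop j.+1 s.
Proof. by move=> js; rewrite -drop_nth // cat_take_drop. Qed.

Lemma size_join_class s j x : (j < size s)%N ->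
  size (join_class s j.+1 x) = size s.
Proof. by move=> js; rewrite /join_class size_set_nth; apply/maxn_idPr. Qed.

Lemma size_new_class s x : size (new_class s x) = (size s).+1.
Proof. exact: size_rcons. Qed.

Lemma nth_new_class s x k :
  nth fset0 (new_class s x) k
  = if k == size s then [fset x]%fset else nth fset0 s k.
Proof.
rewrite /new_class nth_rcons; case: ltngtP => // h.
by rewrite nth_default // ltnW.
Qed.

Lemma nth_join_class s j x k :
  nth fset0 (join_class s j.+1 x) k
  = if k == j then (x |` nth fset0 s j)%fset else nth fset0 s k.
Proof. by rewrite /join_class nth_set_nth nth_class_succ /=. Qed.

Lemma mem_nth_child n s c k y : c \in children n s -> y != n.+1 ->
  (y \in nth fset0 c k) = (y \in nth fset0 s k).
Proof.
move=> /childrenP[->|[j js ->]] yn.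
  rewrite nth_new_class; case: eqVneq => // ->.
  by rewrite inE (negbTE yn) nth_default.
by rewrite nth_join_class; case: eqVneq => // ->; rewrite inE in_fset1 (negbTE yn).
Qed.

Lemma size_child n s c : c \in children n s -> (size s <= size c)%N.
Proof.
move=> /childrenP[->|[j js ->]]; first by rewrite size_new_class.
by rewrite size_join_class.
Qed.

Lemma reachable_class n s A : reachable n s -> A \in s ->
  A != fset0 /\ (A `<=` integers_upto n)%fset.
Proof.
move=> r; elim: r A => //= {}n {}s c _ IH cs A.
have widen B : (B `<=` integers_upto n -> B `<=` integers_upto n.+1)%fset.
  move=> /fsubsetP Bn; apply/fsubsetP => x /Bn; rewrite !integers_uptoE; lia.
case/childrenP: cs => [->|[j js ->]].
  rewrite mem_rcons inE => /orP[/eqP ->|/IH[? ?]]; last by split=> //; exact: widen.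
  split; first by apply/fset0Pn; exists n.+1; rewrite inE.
  by rewrite fsub1set integers_uptoE leqnn.
have old B : B \in s -> B != fset0 /\ (B `<=` integers_upto n.+1)%fset.
  by move=> /IH[? ?]; split=> //; exact: widen.
rewrite join_classE// mem_cat inE => /or3P[/mem_take/old//|/eqP ->|/mem_drop/old//].
have [_ sub] := old _ (mem_nth fset0 js).
split; first by apply/fset0Pn; exists n.+1; rewrite fset1U1.
by rewrite fsubUset sub andbT fsub1set integers_uptoE leqnn.
Qed.

Lemma reachable_notin n s k : reachable n s -> n.+1 \notin nth fset0 s k.
Proof.
move=> r; have [ks|ks] := ltnP k (size s); last by rewrite nth_default.
have [_ /fsubsetP sub] := reachable_class r (mem_nth fset0 ks).
by apply/negP => /sub; rewrite integers_uptoE ltnn andbF.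
Qed.

Lemma reachable_card_gt0 n s k : reachable n s -> (k < size s)%N ->
  (0 < #|` nth fset0 s k|)%N.
Proof.
by move=> r ks; rewrite cardfs_gt0; case: (reachable_class r (mem_nth fset0 ks)).
Qed.

Lemma card_join n s j : reachable n s ->
  #|` (n.+1 |` nth fset0 s j)%fset| = #|` nth fset0 s j|.+1.
Proof. by move=> r; rewrite cardfsU1 (reachable_notin _ r). Qed.

Lemma reachable_sum_card n s : reachable n s ->
  (\sum_(j < size s) #|` nth fset0 s j|)%N = n.
Proof.
move=> r; elim: (r) => [|{}n {}s c {}r IH]; first by rewrite big_ord0.
move=> /childrenP[->|[j js ->]].
  rewrite size_new_class big_ord_recr /= nth_new_class eqxx cardfs1 addn1.
  rewrite -[in RHS]IH; congr (_.+1); apply: eq_bigr => k _.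
  by rewrite nth_new_class; case: eqVneq => // h; have := ltn_ord k; rewrite h ltnn.
rewrite size_join_class // (bigD1 (Ordinal js)) //= nth_join_class eqxx.
rewrite card_join // -[in RHS]IH [in RHS](bigD1 (Ordinal js)) //= addSn.
congr (_ + _).+1; apply: eq_bigr => k kj.
by rewrite nth_join_class; case: eqVneq => // h; case/eqP: kj; apply: val_inj.
Qed.

Lemma reachable_size n s : reachable n s -> (size s <= n)%N.
Proof.
move=> r; rewrite -[leqRHS](reachable_sum_card r) -{1}(card_ord (size s)) -sum1_card.
by apply: leq_sum => k _; exact: (reachable_card_gt0 r).
Qed.

Lemma reachable_size_gt0 n s : reachable n s -> (0 < n)%N -> (0 < size s)%N.
Proof.
move=> r; rewrite -[n in (0 < n)%N](reachable_sum_card r).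
by case: (size s) => //; rewrite big_ord0.
Qed.

(** The n classes are nonempty and their sizes add up to n. This serves the degenerate case n =
    alpha k, where all classes are singletons. *)
Lemma reachable_card_size n s k : reachable n s -> size s = n ->
  (k < size s)%N -> #|` nth fset0 s k| = 1%N.
Proof.
move=> r sn ks; apply/eqP.
rewrite eqn_leq (reachable_card_gt0 r) // andbT.
have := reachable_sum_card r; rewrite (bigD1 (Ordinal ks)) //= -sn.
set S := (\sum_(_ < _ | _) _)%N => E; have : ((size s).-1 <= S)%N.
  rewrite -{1}(card_ord (size s)) -(cardC1 (Ordinal ks)) -sum1_card.
  by apply: leq_sum => i _; exact: (reachable_card_gt0 r).
clearbody S; lia.
Qed.

Lemma restrict_child n s c : reachable n s -> c \in children n s ->
  restrict_partition n c = s.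
Proof.
move=> r.
have idn (t : seq {fset nat}) : {subset t <= s} -> restrict_partition n t = t.
  move=> ts; apply: restrict_id => [|A /ts/(reachable_class r)[]//].
  by apply/negP => /ts/(reachable_class r)[/eqP].
have n1 : ([fset n.+1] `&` integers_upto n = fset0)%fset.
  by apply/fsetP => x; rewrite !inE /= mem_iota; apply/negP; lia.
move=> /childrenP[->|[j js ->]].
  by rewrite /new_class -cats1 restrict_cat idn // /restrict_partition /= n1 eqxx cats0.
have [A0 An] := reachable_class r (mem_nth fset0 js).
rewrite join_classE // [RHS](split_nth js) -cat1s restrict_cat (restrict_cat _ [:: _]).
rewrite (idn (take j s)) => [|A]; last exact: mem_take.
rewrite (idn (drop j.+1 s)) => [|A]; last exact: mem_drop.
by rewrite /restrict_partition /= fsetIUl n1 fset0U (fsetIidPl An) A0.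
Qed.

(** A new class changes the length of the list; two joins differ in the class that receives [n.+1].
    Integrals over a state therefore split over its children without repetition. *)
Lemma uniq_children n s : reachable n s -> uniq (children n s).
Proof.
move=> r; rewrite /children /=; apply/andP; split.
  apply/mapP => -[j]; rewrite mem_iota /= => js /(congr1 size).
  by rewrite size_new_class size_join_class //; lia.
rewrite map_inj_in_uniq ?iota_uniq // => j k; rewrite !mem_iota /= => js ks E.
have := congr1 (fun t => n.+1 \in nth fset0 t j) E.
rewrite !nth_join_class eqxx fset1U1; case: eqVneq => // _.
by rewrite (negbTE (reachable_notin _ r)).
Qed.

Lemma sum_children (M : nmodType) n s (F : seq {fset nat} -> M) :
  \sum_(c <- children n s) F c
  = F (new_class s n.+1) + \sum_(j < size s) F (join_class s j.+1 n.+1).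
Proof.
by rewrite big_cons big_map -{1}[size s]subn0 -/(index_iota 0 (size s)) big_mkord.
Qed.

End OrderedPartitions.

(** * Rising and falling factorials, Gibbs weights, and their one-step identities *)

Section Weights.

Variables (R : realType) (alpha : R).
Implicit Types (s c : seq {fset nat}) (J : pred nat) (a b : nat) (x : R).

Lemma rising0 x : rising x 0 = 1.
Proof. by rewrite /rising big_ord0. Qed.

Lemma risingS x a : rising x a.+1 = rising x a * (x + a%:R).
Proof. by rewrite /rising big_ord_recr. Qed.

Lemma risingSl x a : rising x a.+1 = x * rising (x + 1) a.
Proof.
rewrite /rising big_ord_recl addr0; congr (_ * _); apply: eq_bigr => i _.
by rewrite -addrA -natr1 [_ + 1]addrC.
Qed.

Definition falling x a : R := \prod_(i < a) (x - i%:R).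

Lemma falling0 x : falling x 0 = 1.
Proof. by rewrite /falling big_ord0. Qed.

Lemma fallingS x a : falling x a.+1 = falling x a * (x - a%:R).
Proof. by rewrite /falling big_ord_recr. Qed.

Lemma falling_zero a : falling 0 a = (a == 0%N)%:R.
Proof.
case: a => [|a]; first by rewrite falling0.
by rewrite /falling big_ord_recl subrr mul0r.
Qed.

(** The difference equation of falling factorials, which drives the moment induction. For a = 0 the
    coefficient a kills the term with [a.-1]. *)
Lemma falling_succ x a :
  falling (x + 1) a = falling x a + a%:R * falling x a.-1.
Proof.
case: a => [|a]; first by rewrite !falling0 mul0r addr0.
rewrite {1}/falling big_ord_recl subr0 (fallingS x) /=.
have -> : \prod_(i < a) (x + 1 - (lift ord0 i)%:R) = falling x a.
  by apply: eq_bigr => i _; rewrite lift0 -natr1; ring.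
by rewrite -natr1; ring.
Qed.

(** The part of P(Pi_n = s) that depends on the class sizes; the other factor is [V n (size s)]. *)
Definition weight s : R :=
  \prod_(j < size s) rising (1 - alpha) (#|` nth fset0 s j|).-1.

Lemma weight_new_class s (y : nat) : weight (new_class s y) = weight s.
Proof.
rewrite /weight size_new_class big_ord_recr /= nth_new_class eqxx cardfs1 rising0.
rewrite mulr1; apply: eq_bigr => j _; rewrite nth_new_class.
by case: eqVneq => // h; have := ltn_ord j; rewrite h ltnn.
Qed.

Lemma weight_join_class n s j : reachable n s -> (j < size s)%N ->
  weight (join_class s j.+1 n.+1) = (#|` nth fset0 s j|%:R - alpha) * weight s.
Proof.
move=> r js; rewrite /weight size_join_class // (bigD1 (Ordinal js)) //=.
rewrite nth_join_class eqxx (card_join _ r) [in RHS](bigD1 (Ordinal js)) //=.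
rewrite (eq_bigr (fun i : 'I__ => rising (1 - alpha) (#|` nth fset0 s i|).-1)); last first.
  move=> i ij; rewrite nth_join_class.
  by case: eqVneq => // h; case/eqP: ij; apply: val_inj.
have := reachable_card_gt0 r js; case: #|` _| => // k _ /=.
by rewrite risingS -natr1; ring.
Qed.

(** J selects among the first m classes, with indices from 0. Once m is at most [size s], a new
    class never enters the selection. *)
Definition mass m J s : nat := (\sum_(j < m | J j) #|` nth fset0 s j|)%N.

Definition discounted_mass m J s : R :=
  \sum_(j < m | J j) (#|` nth fset0 s j|%:R - alpha).

Lemma mass_new_class m J s (y : nat) : (m <= size s)%N ->
  mass m J (new_class s y) = mass m J s.
Proof.
move=> ms; apply: eq_bigr => j _; rewrite nth_new_class.
by case: eqVneq => // h; have := ltn_ord j; rewrite h ltnNge ms.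
Qed.

Lemma mass_join_class n m J s j : reachable n s ->
  mass m J (join_class s j.+1 n.+1) = (mass m J s + (J j && (j < m)))%N.
Proof.
move=> r; have [/andP[Jj jm]|Jjm] := boolP (J j && (j < m)%N).
  rewrite /mass (bigD1 (Ordinal jm)) //= [in RHS](bigD1 (Ordinal jm)) //=.
  rewrite nth_join_class eqxx (card_join _ r) addn1 addSn; congr (_ + _).+1.
  apply: eq_bigr => i /andP[_ ij]; rewrite nth_join_class.
  by case: eqVneq => // h; case/eqP: ij; apply: val_inj.
rewrite addn0; apply: eq_bigr => i Ji; rewrite nth_join_class.
by case: eqVneq => // h; move: Jjm; rewrite -h Ji ltn_ord.
Qed.

Lemma discounted_massE m J s :
  discounted_mass m J s = (mass m J s)%:R - alpha * (\sum_(j < m | J j) 1)%N%:R.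
Proof.
rewrite /discounted_mass sumrB /mass !natr_sum; congr (_ - _).
by rewrite mulr_sumr; apply: eq_bigr => j _; rewrite mulr1.
Qed.

Lemma mass_le_child n m J s c : reachable n s -> (m <= size s)%N ->
  c \in children n s -> (mass m J s <= mass m J c <= (mass m J s).+1)%N.
Proof.
move=> r ms /childrenP[->|[j js ->]]; first by rewrite mass_new_class // leqnSn leqnn.
by rewrite (mass_join_class _ _ _ r); lia.
Qed.

(** The mass grows by 1 for a join to a selected class and by 0 for every other child, so the factor
    acts as an indicator. *)
Lemma sum_mass_increment n m J s (F : seq {fset nat} -> R) :
  reachable n s -> (m <= size s)%N ->
  \sum_(c <- children n s) ((mass m J c)%:R - (mass m J s)%:R) * F c
  = \sum_(j < m | J j) F (join_class s j.+1 n.+1).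
Proof.
move=> r ms; rewrite sum_children mass_new_class // subrr mul0r add0r.
rewrite (big_ord_widen_cond _ (fun j => J j) (fun j => F (join_class s j.+1 n.+1)) ms).
rewrite [RHS]big_mkcond; apply: eq_bigr => j _.
rewrite (mass_join_class _ _ _ r) natrD addrAC subrr add0r.
by case: (_ && _); rewrite ?mul1r ?mul0r.
Qed.

Lemma mass_le n m J s : reachable n s -> (mass m J s <= n)%N.
Proof.
move=> r; rewrite -[leqRHS](reachable_sum_card r) /mass.
have [ms|/ltnW ms] := leqP m (size s).
  rewrite (big_ord_widen_cond _ (fun j => J j) (fun j => #|` nth fset0 s j|) ms).
  rewrite big_mkcond; apply: leq_sum => i _; by case: ifP.
rewrite (big_ord_widen _ (fun j => #|` nth fset0 s j|) ms) big_mkcond [leqRHS]big_mkcond /=.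
apply: leq_sum => i _; case: ifP => _; case: ltnP => // h.
by rewrite nth_default // cardfs0.
Qed.

Variable V : nat -> nat -> R.
Hypothesis alpha1 : alpha <= 1.
Hypothesis gV : gibbs_coefficients alpha V.

Let Vrec n k : (0 < k <= n)%N ->
  V n k = (n%:R - alpha * k%:R) * V n.+1 k + V n.+1 k.+1.
Proof. by case: gV => _ _; apply. Qed.

Let V_ge0 n k : (0 < k <= n)%N -> 0 <= V n k.
Proof. by case: gV => + _ _; apply. Qed.

Lemma sum_discounted n s : reachable n s ->
  \sum_(j < size s) (#|` nth fset0 s j|%:R - alpha) = n%:R - alpha * (size s)%:R.
Proof.
by move=> r; rewrite sumrB -natr_sum (reachable_sum_card r) sumr_const card_ord mulr_natr.
Qed.

(* The conditional probability that the next b elements all fall in the classes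
   of J is rising Y b * V (n + b) k / V n k; this is its martingale property. *)
Lemma rising_mass_martingale n m J s b : reachable n s -> (0 < n)%N ->
  (m <= size s)%N ->
  \sum_(c <- children n s)
     rising (discounted_mass m J c) b * V (n.+1 + b)%N (size c) * weight c
  = rising (discounted_mass m J s) b * V (n + b)%N (size s) * weight s.
Proof.
move=> r n0 ms; rewrite sum_children size_new_class weight_new_class.
rewrite !discounted_massE mass_new_class // -discounted_massE.
set Y := discounted_mass m J s.
pose g (j : nat) := #|` nth fset0 s j|%:R - alpha.
(* Every join contributes the term with Y unchanged; joins to a selected class add a correction,
   since they move Y to Y + 1. *)
have -> : \sum_(j < size s) rising (discounted_mass m J (join_class s j.+1 n.+1)) b
     * V (n.+1 + b)%N (size (join_class s j.+1 n.+1)) * weight (join_class s j.+1 n.+1)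
  = V (n.+1 + b)%N (size s) * weight s *
    (\sum_(j < size s) g j * rising Y b +
     \sum_(j < m | J j) g j * (rising (Y + 1) b - rising Y b)).
  rewrite (big_ord_widen_cond _ (fun j => J j) (fun j => g j * _) ms).
  rewrite [X in _ + X]big_mkcond -big_split mulr_sumr; apply: eq_bigr => j _ /=.
  rewrite size_join_class // (weight_join_class r) // discounted_massE.
  rewrite (mass_join_class _ _ _ r) natrD addrAC -discounted_massE -/Y -/(g j).
  by case: ifP => _; rewrite /= ?addr0; ring.
rewrite -!mulr_suml (sum_discounted r) -/Y.
have k0 := reachable_size_gt0 r n0; have kn := reachable_size r.
rewrite (Vrec (n := n + b)) ?k0 ?(leq_trans kn) ?leq_addr //.
(* This turns the correction into b times [rising Y b], so that n - alpha k becomes n + b - alpha k,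
   the coefficient in the recursion of V at n + b. *)
have Yr : Y * rising (Y + 1) b = rising Y b * (Y + b%:R) by rewrite -risingSl risingS.
rewrite !addSn natrD.
transitivity (weight s * (rising Y b * V (n + b).+1 (size s).+1 + V (n + b).+1 (size s) *
  ((n%:R - alpha * (size s)%:R) * rising Y b + (Y * rising (Y + 1) b - Y * rising Y b)))).
  by rewrite -/(discounted_mass m J s) -/Y; ring.
by rewrite Yr; ring.
Qed.

(** The joining weights of the selected classes add up to Y, and Y times [rising (Y + 1) b] is
    [rising Y b.+1]. *)
Lemma rising_mass_step n m J s b : reachable n s -> (m <= size s)%N ->
  \sum_(j < m | J j) rising (discounted_mass m J (join_class s j.+1 n.+1)) b
     * V (n.+1 + b)%N (size s) * weight (join_class s j.+1 n.+1)
  = rising (discounted_mass m J s) b.+1 * V (n.+1 + b)%N (size s) * weight s.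
Proof.
move=> r ms; rewrite risingSl {2}/discounted_mass !mulr_suml.
apply: eq_bigr => j Jj; rewrite (weight_join_class r) ?(leq_trans _ ms) //.
rewrite discounted_massE (mass_join_class _ _ _ r) Jj ltn_ord /= natrD addrAC.
by rewrite -discounted_massE; ring.
Qed.

(** A vanishing sum of two nonnegative terms has vanishing terms; the side condition makes n - alpha
    k positive. This handles states of probability zero, about which the transition rules say
    nothing. *)
Lemma gibbs_zero n k : (0 < k <= n)%N -> V n k = 0 ->
  V n.+1 k.+1 = 0 /\ ((k < n)%N \/ alpha < 1 -> V n.+1 k = 0).
Proof.
move=> kn; have := kn => /andP[k0 kn'].
have d0 : 0 <= n%:R - alpha * k%:R.
  have : k%:R <= n%:R :> R by rewrite ler_nat.
  have : 0 <= k%:R :> R by rewrite ler0n.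
  by move: alpha1; nra.
have v1 : 0 <= V n.+1 k.+1 by apply: V_ge0; lia.
have v2 : 0 <= V n.+1 k by apply: V_ge0; lia.
rewrite (Vrec kn) => /eqP; rewrite paddr_eq0 ?mulr_ge0 // => /andP[/eqP p /eqP q].
split=> // h; apply/eqP; move/eqP: p; rewrite mulf_eq0 => /orP[|//].
suff : 0 < n%:R - alpha * k%:R by move=> /gt_eqF ->.
have k1 : 1 <= k%:R :> R by rewrite ler1n.
have kn2 : k%:R <= n%:R :> R by rewrite ler_nat.
case: h => h; last by nra.
by have : k%:R < n%:R :> R; [rewrite ltr_nat|move: alpha1 k1; nra].
Qed.

End Weights.

(** * Bounded measurable functions and their integrals *)

Section BoundedMeasurable.

Context d (T : measurableType d) (R : realType) (P : probability T R).
Implicit Types (f g : T -> R).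

(** Under a probability measure this is integrability in a form closed under products and powers;
    all real-valued integrands below are of this kind. *)
Definition bounded_mfun f : Prop :=
  measurable_fun setT f /\ exists M, forall w, `|f w| <= M.

Lemma bounded_mfun_cst r : bounded_mfun (fun=> r).
Proof. by split; [exact: measurable_cst|exists `|r|]. Qed.

Lemma bounded_mfunD f g : bounded_mfun f -> bounded_mfun g ->
  bounded_mfun (fun w => f w + g w).
Proof.
move=> [mf [M fM]] [mg [N gN]]; split; first exact: measurable_funD.
by exists (M + N) => w; apply: le_trans (ler_normD _ _) (lerD _ _).
Qed.

Lemma bounded_mfunM f g : bounded_mfun f -> bounded_mfun g ->
  bounded_mfun (fun w => f w * g w).
Proof.
move=> [mf [M fM]] [mg [N gN]]; split; first exact: measurable_funM.
by exists (M * N) => w; rewrite normrM ler_pM.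
Qed.

Lemma bounded_mfunB f g : bounded_mfun f -> bounded_mfun g ->
  bounded_mfun (fun w => f w - g w).
Proof.
move=> bf bg; have -> : (fun w => f w - g w) = (fun w => f w + -1 * g w).
  by apply/funext => w; rewrite mulN1r.
by apply: bounded_mfunD => //; apply: bounded_mfunM => //; exact: bounded_mfun_cst.
Qed.

Lemma bounded_mfunX f n : bounded_mfun f -> bounded_mfun (fun w => f w ^+ n).
Proof.
move=> bf; elim: n => [|n IH]; first exact: bounded_mfun_cst.
have -> : (fun w => f w ^+ n.+1) = (fun w => f w * f w ^+ n).
  by apply/funext => w; rewrite exprS.
exact: bounded_mfunM.
Qed.

Lemma bounded_mfun_sum (I : Type) (r : seq I) (p : pred I) (F : I -> T -> R) :
  (forall i, bounded_mfun (F i)) ->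
  bounded_mfun (fun w => \sum_(i <- r | p i) F i w).
Proof.
move=> bF; elim: r => [|i r IH].
  have -> : (fun w => \sum_(i <- [::] | p i) F i w) = (fun=> 0).
    by apply/funext => w; rewrite big_nil.
  exact: bounded_mfun_cst.
have -> : (fun w => \sum_(i <- i :: r | p i) F i w)
    = (fun w => (if p i then F i w else 0) + \sum_(i <- r | p i) F i w).
  by apply/funext => w; rewrite big_cons; case: ifP; rewrite ?add0r.
by apply: bounded_mfunD => //; case: (p i) => //; exact: bounded_mfun_cst.
Qed.

Lemma bounded_mfun_integrable f A : bounded_mfun f -> measurable A ->
  P.-integrable A (EFin \o f).
Proof.
move=> [mf [M fM]] mA; apply: measurable_bounded_integrable => //.
- exact: le_lt_trans (probability_le1 P mA) (ltry _).
- exact: measurable_funS mf.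
- exists M; split; first by rewrite num_real.
  by move=> x Mx w _; exact: le_trans (fM w) (ltW Mx).
Qed.

Lemma integral_bounded_mfunE f A : bounded_mfun f -> measurable A ->
  (\int[P]_(w in A) (f w)%:E = (\int[P]_(w in A) f w)%:E)%E.
Proof.
move=> bf mA; rewrite /Rintegral fineK //.
by apply: integrable_fin_num => //; exact: (bounded_mfun_integrable bf).
Qed.

Lemma Rintegral_bounded_mfunD f g A : bounded_mfun f -> bounded_mfun g ->
  measurable A ->
  \int[P]_(w in A) (f w + g w) = \int[P]_(w in A) f w + \int[P]_(w in A) g w.
Proof. by move=> *; apply: RintegralD => //; exact: bounded_mfun_integrable. Qed.

Lemma Rintegral_bounded_mfunZ r f A : bounded_mfun f -> measurable A ->
  \int[P]_(w in A) (r * f w) = r * \int[P]_(w in A) f w.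
Proof. by move=> *; apply: RintegralZl => //; exact: bounded_mfun_integrable. Qed.

End BoundedMeasurable.

(** * The law of the partition at a fixed time *)

Section GibbsPartition.

Context d (T : measurableType d) (R : realType) (P : probability T R).
Variables (alpha : R) (V : nat -> nat -> R) (Pi : nat -> T -> seq {fset nat}).
Hypothesis alpha1 : alpha <= 1.
Hypothesis gV : gibbs_coefficients alpha V.
Hypothesis hPi : EGP P alpha V Pi.
Implicit Types (s c : seq {fset nat}) (w : T) (n m : nat).

Definition state n s : set T := [set w | Pi n w = s].

Lemma measurable_state n s : measurable (state n s).
Proof. by case: hPi => -[+ _ _] _ _; exact. Qed.

Lemma Pi_child n w : Pi n.+1 w \in children n (Pi n w).
Proof.
case: hPi => -[_ opn cons] _ _; rewrite (cons n w).
exact: ordered_partition_children.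
Qed.

Lemma reachable_Pi n w : reachable n (Pi n w).
Proof.
elim: n => [|n IH]; last exact: reachable_child (Pi_child n w).
case: hPi => -[_ /(_ 0%N w) /and4P[s0 _ /eqP cov _] _] _ _.
suff -> : Pi 0 w = [::] by exact: reachable_nil.
case: (Pi 0 w) s0 cov => // A s; rewrite inE negb_or => /andP[/eqP A0 _] /fsetP cov.
case: A0; apply/esym/fsetP => x; rewrite inE; apply/negP => xA.
have := cov x; rewrite big_cons !inE /= xA /= => h; by have := esym h.
Qed.

Lemma stateE n s : reachable n s ->
  state n s = \big[setU/set0]_(c <- children n s) state n.+1 c.
Proof.
move=> r; apply/seteqP; split=> w; rewrite -bigcup_seq.
  by move=> <-; exists (Pi n.+1 w) => //; exact: Pi_child.
move=> [c /= cs]; rewrite /state /= => cw.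
by case: hPi => -[_ _ cons] _ _; rewrite (cons n w) cw (restrict_child r cs).
Qed.

(** The event E stays fixed while the state is refined: it is the whole space in the moment
    recursions and the record event at the end. *)
Lemma Rintegral_state (f : T -> R) E n s : bounded_mfun f -> measurable E ->
  reachable n s ->
  \int[P]_(w in state n s `&` E) f w
  = \sum_(c <- children n s) \int[P]_(w in state n.+1 c `&` E) f w.
Proof.
move=> bf mE r; apply: EFin_inj.
have mc m c : measurable (state m c `&` E).
  by apply: measurableI => //; exact: measurable_state.
rewrite -integral_bounded_mfunE // (stateE r) big_distrl /=.
rewrite integral_bigsetU_EFin ?uniq_children //.
- by rewrite -sumEFin; apply: eq_bigr => c _; rewrite integral_bounded_mfunE.
- apply/trivIsetP => a b _ _ ab; rewrite -subset0 => w [[+ _] [+ _]].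
  by rewrite /state/= => -> ab'; move: ab; rewrite ab' eqxx.
- apply: (@measurable_funTS _ _ _ _ _ (EFin \o f)); apply/measurable_EFinP.
  by case: bf.
Qed.

(** Sequences of finite sets form a countable type, so every preimage is a countable union of state
    events. *)
Lemma measurable_fun_Pi (f : seq {fset nat} -> R) n :
  measurable_fun setT (fun w => f (Pi n w)).
Proof.
move=> _ B mB; rewrite setTI.
have -> : (fun w => f (Pi n w)) @^-1` B
    = \bigcup_s (if pselect (B (f s)) then state n s else set0).
  apply/seteqP; split=> w /=.
    by move=> Bw; exists (Pi n w) => //; case: pselect.
  by move=> [s _]; case: pselect => //= Bs ->.
apply: countable_bigcupT_measurable; first exact: countableP.
by move=> s; case: pselect => ? /=; [exact: measurable_state|exact: measurable0].
Qed.

Lemma bounded_mfun_mass n m J : bounded_mfun (fun w => (mass m J (Pi n w))%:R : R).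
Proof.
split; first exact: (measurable_fun_Pi (fun s => (mass m J s)%:R)).
exists n%:R => w; rewrite normr_nat ler_nat; apply: mass_le; exact: reachable_Pi.
Qed.

(** Induction along the history of s: the transition probability times the formula for the parent is
    the formula for the child. Parents of probability zero need a separate argument. *)
Lemma prob_state n s : reachable n s -> (0 < n)%N ->
  P (state n s) = (V n (size s) * weight alpha s)%:E.
Proof.
case: hPi => _ Pnew Pjoin r; elim: (r) => // {}n {}s c {}r IH cs _.
have [n0|n0] := posnP n.
  move: n0 r cs IH => -> r; have := reachable_size r; case: s r => // r _.
  move=> /childrenP[->|[]//] _.
  have -> : state 1 (new_class [::] 1) = setT.
    apply/seteqP; split=> // w _; have := Pi_child 0 w.
    have := reachable_size (reachable_Pi 0 w); case: (Pi 0 w) => // _.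
    by move=> /childrenP[|[]//].
  rewrite probability_setT weight_new_class size_new_class /weight big_ord0 mulr1.
  by case: gV => _ ->.
have {}IH := IH n0.
have csub : state n.+1 c `<=` state n s.
  by rewrite (stateE r) -bigcup_seq => w cw; exists c.
have k0 := reachable_size_gt0 r n0; have kn := reachable_size r.
have kn' : (0 < size s <= n)%N by rewrite k0.
have Vrec : V n (size s) = (n%:R - alpha * (size s)%:R) * V n.+1 (size s) + V n.+1 (size s).+1.
  by case: gV => _ _; apply.
(* Equality n = alpha k with alpha <= 1 and k <= n forces alpha = 1 and k = n, so the classes are
   singletons and the joining weight vanishes, in accordance with the convention for division by
   zero. *)
have zero j : (j < size s)%N -> n%:R - alpha * (size s)%:R = 0 ->
    #|` nth fset0 s j|%:R - alpha = 0.
  move=> js /eqP; rewrite subr_eq0 => /eqP E.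
  have k1 : 1 <= (size s)%:R :> R by rewrite ler1n.
  have kn1 : (size s)%:R <= n%:R :> R by rewrite ler_nat.
  have ak : alpha * (size s)%:R <= (size s)%:R by rewrite ler_piMl ?ler0n.
  have nk : n%:R = (size s)%:R :> R by apply/eqP; rewrite eq_le kn1 E ak.
  have a1 : alpha = 1.
    by apply: (mulIf (x := (size s)%:R)); rewrite ?pnatr_eq0 -?lt0n // -E mul1r.
  have /eqP := nk; rewrite eqr_nat => /eqP nk'.
  by rewrite (reachable_card_size r) // a1 subrr.
(* A null parent has null children, and the claimed formula must be shown to vanish too, through V
   or through the weight. *)
have [p0|p0] := eqVneq (V n (size s) * weight alpha s) 0.
  have -> : P (state n.+1 c) = 0.
    have : (P (state n.+1 c) <= P (state n s))%E.
      by rewrite le_measure ?inE //; exact: measurable_state.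
    by rewrite IH p0 measure_le0 => /eqP.
  move/eqP: p0; rewrite mulf_eq0 => /orP[/eqP V0|/eqP w0]; last first.
    case/childrenP: cs => [->|[j js ->]]; first by rewrite weight_new_class w0 mulr0.
    by rewrite (weight_join_class _ r) // w0 !mulr0.
  have [v1 v2] := gibbs_zero alpha1 gV kn' V0.
  case/childrenP: cs => [->|[j js ->]]; first by rewrite size_new_class v1 mul0r.
  rewrite size_join_class // (weight_join_class _ r) //.
  have [d0|d0] := eqVneq (n%:R - alpha * (size s)%:R) 0.
    by rewrite zero // mul0r mulr0.
  by move: (gibbs_zero alpha1 gV kn' V0) => [+ _]; move: V0; rewrite Vrec => + v1';
    rewrite v1' addr0 => /eqP; rewrite mulf_eq0 (negbTE d0) => /eqP ->; rewrite mul0r.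
have Ps : (0 < P (state n s))%E.
  by rewrite lt0e measure_ge0 andbT IH eqe.
have cprob x : cond_prob P (state n.+1 c) (state n s) = x%:E ->
    P (state n.+1 c) = (x * (V n (size s) * weight alpha s))%:E.
  rewrite /cond_prob (setIidl csub) IH inver (negbTE p0) EFinM => <-.
  by rewrite -muleA -EFinM mulVf // mule1.
move: p0; rewrite mulf_eq0 negb_or => /andP[V0 _].
case/childrenP: cs => [cE|[j js cE]]; move: cprob; rewrite cE => cprob.
  rewrite (cprob _ (Pnew n s n0 Ps)) size_new_class weight_new_class.
  by congr EFin; field.
rewrite (cprob _ (Pjoin n s j.+1 n0 Ps js)) size_join_class // (weight_join_class _ r) //.
have [d0|d0] := eqVneq (n%:R - alpha * (size s)%:R) 0.
  by rewrite nth_class_succ zero // !mul0r mulr0.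
rewrite nth_class_succ; congr EFin.
(* By the recursion, 1 - V_{n+1,k+1}/V_{n,k} has the factor n - alpha k, which cancels the
   denominator of the joining probability. *)
have -> : V n.+1 (size s).+1 = V n (size s) - (n%:R - alpha * (size s)%:R) * V n.+1 (size s).
  by rewrite {1}Vrec; ring.
by field; rewrite d0 V0.
Qed.

Lemma Rintegral_cst_state n s (x : R) : reachable n s -> (0 < n)%N ->
  \int[P]_(w in state n s) x = x * (V n (size s) * weight alpha s).
Proof.
move=> r n0; rewrite Rintegral_cst; last exact: measurable_state.
by congr (_ * _); have /(congr1 fine) := prob_state r n0.
Qed.
End GibbsPartition.

(** * Moments of the number of elements that join the selected classes *)

Section Moments.

Context d (T : measurableType d) (R : realType) (P : probability T R).
Variables (alpha : R) (V : nat -> nat -> R) (Pi : nat -> T -> seq {fset nat}).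
Hypothesis alpha1 : alpha <= 1.
Hypothesis gV : gibbs_coefficients alpha V.
Hypothesis hPi : EGP P alpha V Pi.
Variables (m : nat) (J : pred nat).
Implicit Types (s c : seq {fset nat}) (w : T) (n : nat).

Definition increment n s L w : R :=
  (mass m J (Pi (n + L) w))%:R - (mass m J s)%:R.

(** This is q_a times P(Pi_n = s). The factor [V n (size s)] has cancelled, so no division by a
    possibly vanishing coefficient occurs. *)
Definition gibbs_moment n s a : R :=
  rising (discounted_mass alpha m J s) a * V (n + a)%N (size s) * weight alpha s.

Lemma bounded_increment n s L : bounded_mfun (increment n s L).
Proof.
by apply: bounded_mfunB; [exact: bounded_mfun_mass hPi _ _ _|exact: bounded_mfun_cst].
Qed.

Lemma bounded_falling (f : T -> R) a : bounded_mfun f ->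
  bounded_mfun (fun w => falling (f w) a).
Proof.
move=> bf; elim: a => [|a IH].
  have -> : (fun w => falling (f w) 0) = (fun=> 1).
    by apply/funext => w; rewrite falling0.
  exact: bounded_mfun_cst.
have -> : (fun w => falling (f w) a.+1) = (fun w => falling (f w) a * (f w - a%:R)).
  by apply/funext => w; rewrite fallingS.
by apply: bounded_mfunM => //; apply: bounded_mfunB => //; exact: bounded_mfun_cst.
Qed.

Lemma Rintegral_children (f : T -> R) n s : bounded_mfun f -> reachable n s ->
  \int[P]_(w in state Pi n s) f w
  = \sum_(c <- children n s) \int[P]_(w in state Pi n.+1 c) f w.
Proof.
move=> bf r; have := Rintegral_state hPi bf measurableT r.
by rewrite setIT => ->; apply: eq_bigr => c _; rewrite setIT.
Qed.

Lemma incrementS n s c L w :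
  increment n s L.+1 w
  = increment n.+1 c L w + ((mass m J c)%:R - (mass m J s)%:R).
Proof. by rewrite /increment addnS addSn addrA subrK. Qed.

Lemma increment_child n s c : reachable n s -> (m <= size s)%N ->
  c \in children n s ->
  (mass m J c)%:R - (mass m J s)%:R = 0 :> R
  \/ (mass m J c)%:R - (mass m J s)%:R = 1 :> R.
Proof.
move=> r ms cs; have := mass_le_child J r ms cs.
rewrite leq_eqVlt => /andP[/orP[/eqP <-|lt] le]; first by left; rewrite subrr.
have -> : mass m J c = (mass m J s).+1 by lia.
by right; rewrite -natr1 addrAC subrr add0r.
Qed.

Lemma sum_gibbs_moment n s a : reachable n s -> (0 < n)%N -> (m <= size s)%N ->
  \sum_(c <- children n s) gibbs_moment n.+1 c a = gibbs_moment n s a.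
Proof. by move=> r n0 ms; exact: rising_mass_martingale. Qed.

Lemma sum_gibbs_moment_step n s a : reachable n s -> (m <= size s)%N ->
  \sum_(c <- children n s)
    ((mass m J c)%:R - (mass m J s)%:R) * gibbs_moment n.+1 c a
  = gibbs_moment n s a.+1.
Proof.
move=> r ms; rewrite (sum_mass_increment _ _ r) // /gibbs_moment.
rewrite addnS -addSn -(rising_mass_step _ _ _ _ r) //; apply: eq_bigr => j _.
by rewrite size_join_class // (leq_trans _ ms).
Qed.

(** Induction on L over the children of s: the increment from s is the increment from the child plus
    0 or 1. After [falling_succ], the martingale identity sums the first part and
    [sum_gibbs_moment_step] the second, and [falling_succ] at L reassembles them. *)
Lemma falling_moment L n s a : reachable n s -> (0 < n)%N -> (m <= size s)%N ->
  \int[P]_(w in state Pi n s) falling (increment n s L w) a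
  = falling L%:R a * gibbs_moment n s a.
Proof.
elim: L n s a => [|L IH] n s a r n0 ms.
  rewrite (@eq_Rintegral _ _ _ _ _ (fun=> (a == 0%N)%:R)); last first.
    by move=> w; rewrite inE /state /= => <-; rewrite /increment addn0 subrr falling_zero.
  rewrite (Rintegral_cst_state alpha1 gV hPi) // falling_zero.
  case: a => [|a]; last by rewrite !mul0r.
  by rewrite /gibbs_moment rising0 addn0 !mul1r.
rewrite Rintegral_children //; last exact/bounded_falling/bounded_increment.
pose e c : R := (mass m J c)%:R - (mass m J s)%:R.
(* The indicator [e c] merges the cases of increment 0 and 1 into one formula that can be summed
   over the children. *)
have step c : c \in children n s ->
    \int[P]_(w in state Pi n.+1 c) falling (increment n s L.+1 w) a
    = falling L%:R a * gibbs_moment n.+1 c a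
      + a%:R * falling L%:R a.-1 * (e c * gibbs_moment n.+1 c a.-1).
  move=> cs; have rc := reachable_child r cs.
  have mc := leq_trans ms (size_child cs).
  under eq_Rintegral => w _ do rewrite (incrementS _ _ c).
  rewrite /e; case: (increment_child r ms cs) => ->.
    under eq_Rintegral => w _ do rewrite addr0.
    by rewrite IH // mul0r mulr0 addr0.
  under eq_Rintegral => w _ do rewrite falling_succ.
  have mS := measurable_state hPi n.+1 c.
  have bf b : bounded_mfun (fun w => falling (increment n.+1 c L w) b).
    exact/bounded_falling/bounded_increment.
  rewrite Rintegral_bounded_mfunD //; last by apply: bounded_mfunM => //; exact: bounded_mfun_cst.
  by rewrite Rintegral_bounded_mfunZ // !IH // mul1r mulrA.
rewrite (eq_big_seq _ step) big_split /= -!mulr_sumr sum_gibbs_moment //.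
rewrite sum_gibbs_moment_step // -[in RHS]natr1 falling_succ.
by case: a {step} => [|a]; rewrite ?mul0r ?addr0 //= mulrDl.
Qed.

(** Among the L M pairs of arrival times, the L diagonal ones contribute q_1 and the remaining L (M
    - 1) contribute q_2. The proof peels off the first arrival. *)
Lemma increment_product_moment L M n s : reachable n s -> (0 < n)%N ->
  (m <= size s)%N -> (L <= M)%N ->
  \int[P]_(w in state Pi n s) (increment n s L w * increment n s M w)
  = L%:R * gibbs_moment n s 1 + L%:R * (M%:R - 1) * gibbs_moment n s 2.
Proof.
elim: L M n s => [|L IH] M n s r n0 ms LM.
  rewrite !mul0r addr0 (@eq_Rintegral _ _ _ _ _ (fun=> 0)).
    by rewrite Rintegral_cst ?mul0r //; exact: measurable_state hPi _ _.
  by move=> w; rewrite inE /state /= => E; rewrite {1}/increment addn0 E subrr mul0r.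
case: M LM => // M LM.
rewrite Rintegral_children //; last by apply: bounded_mfunM; exact: bounded_increment.
pose e c : R := (mass m J c)%:R - (mass m J s)%:R.
have step c : c \in children n s ->
    \int[P]_(w in state Pi n.+1 c) (increment n s L.+1 w * increment n s M.+1 w)
    = L%:R * gibbs_moment n.+1 c 1 + L%:R * (M%:R - 1) * gibbs_moment n.+1 c 2
      + (L%:R + M%:R) * (e c * gibbs_moment n.+1 c 1) + e c * gibbs_moment n.+1 c 0.
  move=> cs; have rc := reachable_child r cs.
  have mc := leq_trans ms (size_child cs).
  under eq_Rintegral => w _ do rewrite !(incrementS _ _ c).
  rewrite /e; case: (increment_child r ms cs) => ->.
    under eq_Rintegral => w _ do rewrite !addr0.
    by rewrite IH // !mul0r mulr0 !addr0.
  have mS := measurable_state hPi n.+1 c.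
  have bI := bounded_increment n.+1 c.
  have first N : \int[P]_(w in state Pi n.+1 c) increment n.+1 c N w
      = N%:R * gibbs_moment n.+1 c 1.
    have := @falling_moment N _ _ 1 rc isT mc; rewrite fallingS falling0 mul1r subr0 => <-.
    by apply: eq_Rintegral => w _; rewrite fallingS falling0 mul1r subr0.
  under eq_Rintegral => w _.
    rewrite mulrDl mul1r mulrDr mulr1 -addrA; over.
  have b1 : bounded_mfun (fun w : T => 1 : R) by exact: bounded_mfun_cst.
  rewrite Rintegral_bounded_mfunD //; [|exact: bounded_mfunM|by do 2! [apply: bounded_mfunD => //]].
  rewrite Rintegral_bounded_mfunD //; last exact: bounded_mfunD.
  rewrite Rintegral_bounded_mfunD // IH // !first (Rintegral_cst_state alpha1 gV hPi) //.
  rewrite /gibbs_moment rising0 addn0 /=; ring.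
rewrite (eq_big_seq _ step) !big_split /= -!mulr_sumr !sum_gibbs_moment //.
by rewrite !sum_gibbs_moment_step // -!natr1; ring.
Qed.

Lemma mean_increment_variance L M n s : reachable n s -> (0 < n)%N ->
  (m <= size s)%N -> (0 < L)%N -> (L <= M)%N ->
  \int[P]_(w in state Pi n s)
    (increment n s L w / L%:R - increment n s M w / M%:R) ^+ 2
  = (gibbs_moment n s 1 - gibbs_moment n s 2) * (L%:R^-1 - M%:R^-1).
Proof.
move=> r n0 ms L0 LM.
have mS := measurable_state hPi n s.
have bI N : bounded_mfun (increment n s N) by exact: bounded_increment.
have bII N N' : bounded_mfun (fun w => increment n s N w * increment n s N' w).
  exact: bounded_mfunM.
have bZ (x : R) (f : T -> R) : bounded_mfun f -> bounded_mfun (fun w => x * f w).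
  by move=> bf; apply: bounded_mfunM => //; exact: bounded_mfun_cst.
rewrite (@eq_Rintegral _ _ _ _ _ (fun w =>
    L%:R^-1 ^+ 2 * (increment n s L w * increment n s L w)
    + (- (2 * L%:R^-1 * M%:R^-1) * (increment n s L w * increment n s M w)
       + M%:R^-1 ^+ 2 * (increment n s M w * increment n s M w)))); last by move=> w _; ring.
rewrite Rintegral_bounded_mfunD //; [|exact: bZ|by apply: bounded_mfunD; exact: bZ].
rewrite Rintegral_bounded_mfunD //; [|exact: bZ|exact: bZ].
rewrite !Rintegral_bounded_mfunZ // !increment_product_moment //.
by field; rewrite !pnatr_eq0; lia.
Qed.

End Moments.

(** * Convergence criteria for real sequences *)

Section Convergence.

Variable R : realType.
Implicit Types (u v : nat -> R) (l : R).

Lemma eq_cvgn u v l : u =1 v -> u @ \oo --> l -> v @ \oo --> l.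
Proof. by move=> /funext ->. Qed.

(** For L between consecutive cubes, monotonicity squeezes u_L / L between the value at the lower
    cube divided by the upper cube and the reverse. Both bounds tend to l because the ratio of
    consecutive cubes tends to 1. *)
Lemma cvg_along_cubes u l : {homo u : p q / (p <= q)%N >-> p <= q} -> 0 <= u 0%N ->
  (fun k => u (k.+1 ^ 3)%N / (k.+1 ^ 3)%N%:R) @ \oo --> l ->
  (fun L => u L / L%:R) @ \oo --> l.
Proof.
move=> u_homo u0 ul; have u_ge0 L : 0 <= u L by rewrite (le_trans u0) ?u_homo.
(* The ratio (k+2)^3 / (k+1)^3, as [harmonic k] is 1/(k+1). *)
pose r k : R := (1 + harmonic k) ^+ 3.
have rl : r @ \oo --> (1 : R).
  have h : (fun k => 1 + harmonic k : R) @ \oo --> (1 + 0 : R).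
    by apply: cvgD; [exact: cvg_cst|exact: cvg_harmonic].
  rewrite addr0 in h.
  have : (fun k => (1 + harmonic k) * ((1 + harmonic k) * (1 + harmonic k)) : R) @ \oo
      --> (1 * (1 * 1) : R) by do 2! [apply: cvgM => //].
  by rewrite !mulr1; apply: eq_cvgn => k; rewrite /r !exprS expr0 mulr1.
have up : (fun k => u (k.+2 ^ 3)%N / (k.+2 ^ 3)%N%:R * r k) @ \oo --> l.
  rewrite -[l]mulr1; apply: cvgM => //.
  by move: ul; rewrite -cvg_shiftS.
have lo : (fun k => u (k.+1 ^ 3)%N / (k.+1 ^ 3)%N%:R / r k) @ \oo --> l.
  rewrite -[l]divr1; apply: cvgM => //; apply: cvgV => //; exact: oner_neq0.
have rE k : r k = (k.+2 ^ 3)%N%:R / (k.+1 ^ 3)%N%:R.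
  rewrite /r /harmonic /= !natrX -expr_div_n; congr (_ ^+ 3).
  by rewrite -[k.+2%:R]natr1 mulrDl divff ?mul1r // pnatr_eq0.
apply/cvgrPdist_lt => e e0.
move/cvgrPdist_lt : up => /(_ _ e0) [K1 _ K1P].
move/cvgrPdist_lt : lo => /(_ _ e0) [K2 _ K2P].
pose K := maxn K1 K2.
exists (K.+1 ^ 3)%N => // L /= KL.
have [k Kk /andP[kL Lk]] : exists2 k, (K <= k)%N & (k.+1 ^ 3 <= L <= k.+2 ^ 3)%N.
  elim: L KL => [|L IH]; first by rewrite leqn0 expn_eq0.
  rewrite leq_eqVlt => /orP[/eqP <-|].
    by exists K => //; rewrite ?leqnn ?leq_exp2r ?leqnSn.
  rewrite ltnS => /IH[k Kk /andP[kL Lk]].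
  have [Lk'|Lk'] := leqP L.+1 (k.+2 ^ 3); first by exists k => //; rewrite Lk' (leq_trans kL).
  exists k.+1; first exact: leq_trans (leqnSn k).
  have -> : L = (k.+2 ^ 3)%N by apply/eqP; rewrite eqn_leq Lk -ltnS.
  by rewrite leqnSn /= ltn_exp2r.
have Lpos : 0 < L%:R :> R by rewrite ltr0n (leq_trans _ kL) // expn_gt0.
have pos j : 0 < (j.+1 ^ 3)%N%:R :> R by rewrite ltr0n expn_gt0.
have := K1P k (leq_trans (leq_maxl _ _) Kk); have := K2P k (leq_trans (leq_maxr _ _) Kk).
rewrite /= !rE.
have -> : u (k.+2 ^ 3)%N / (k.+2 ^ 3)%N%:R * ((k.+2 ^ 3)%N%:R / (k.+1 ^ 3)%N%:R)
    = u (k.+2 ^ 3)%N / (k.+1 ^ 3)%N%:R by rewrite mulrA divfK // gt_eqF.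
have -> : u (k.+1 ^ 3)%N / (k.+1 ^ 3)%N%:R / ((k.+2 ^ 3)%N%:R / (k.+1 ^ 3)%N%:R)
    = u (k.+1 ^ 3)%N / (k.+2 ^ 3)%N%:R.
  by rewrite invf_div mulrA divfK // gt_eqF.
have le1 : u (k.+1 ^ 3)%N / (k.+2 ^ 3)%N%:R <= u L / L%:R.
  by rewrite ler_pM ?invr_ge0 ?ler0n ?u_homo // lef_pV2 ?ler_nat // posrE.
have le2 : u L / L%:R <= u (k.+2 ^ 3)%N / (k.+1 ^ 3)%N%:R.
  by rewrite ler_pM ?invr_ge0 ?ler0n ?u_homo // lef_pV2 ?ler_nat // posrE.
have squeeze x y z : y <= x -> x <= z -> `|l - y| < e -> `|l - z| < e -> `|l - x| < e.
  by rewrite !ltr_norml => ? ? /andP[? ?] /andP[? ?]; apply/andP; split; lra.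
exact: squeeze le1 le2.
Qed.

Lemma sum_inv_pronic n :
  \sum_(0 <= k < n) (k.+1%:R * k.+2%:R)^-1 = 1 - n.+1%:R^-1 :> R.
Proof.
have -> : \sum_(0 <= k < n) (k.+1%:R * k.+2%:R : R)^-1
    = \sum_(0 <= k < n) (- k.+2%:R^-1 - - k.+1%:R^-1).
  apply: eq_bigr => k _; rewrite -[k.+2%:R]natr1 -[k.+1%:R]natr1.
  by field; rewrite !natr1 !pnatr_eq0.
by rewrite (telescope_sumr (fun k => - k.+1%:R^-1)) // invr1 opprK addrC.
Qed.

(** With a = (k+1)(k+2), an increment x satisfies |x| <= 1/a + a x^2, and both terms are summable;
    hence the telescoping series converges absolutely. *)
Lemma is_cvg_summable_increments u :
  (\sum_(0 <= k <oo)
     ((u k - u k.+1) ^+ 2 * (k.+1%:R * k.+2%:R))%:E)%E \is a fin_num ->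
  cvgn u.
Proof.
set S := (\sum_(0 <= k <oo) _)%E => Sfin.
pose t k : R := (k.+1%:R * k.+2%:R)^-1.
have S_ge n : \sum_(0 <= k < n) (u k - u k.+1) ^+ 2 * (k.+1%:R * k.+2%:R) <= fine S.
  rewrite -lee_fin fineK // -sumEFin; apply: nneseries_lim_ge => k _ _.
  by rewrite lee_fin mulr_ge0 // ?sqr_ge0 // mulr_ge0.
have abs k : `|telescope u k| <= t k + (u k - u k.+1) ^+ 2 * (k.+1%:R * k.+2%:R).
  rewrite /telescope /= distrC /t; set a := k.+1%:R * k.+2%:R.
  have a0 : 0 < a :> R by rewrite mulr_gt0.
  rewrite -(real_normK (num_real (u k - u k.+1))); set x := `|_|.
  have x0 : 0 <= x by exact: normr_ge0.
  (* Completing the square exhibits the excess over x as nonnegative. *)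
  have -> : a^-1 + x ^+ 2 * a = x + a^-1 * ((1 - x * a / 2) ^+ 2 + 3 / 4 * (x * a) ^+ 2).
    by field; rewrite gt_eqF.
  rewrite lerDl mulr_ge0 ?invr_ge0 ?(ltW a0) //.
  by rewrite addr_ge0 ?sqr_ge0 // mulr_ge0 ?sqr_ge0.
have cs : cvgn (series (telescope u)).
  apply: normed_cvg; apply: nondecreasing_is_cvgn.
    by apply: nondecreasing_series => k _ _; exact: normr_ge0.
  exists (1 + fine S) => _ [n _ <-]; rewrite /series /=.
  apply: le_trans (ler_sum _ (fun k _ => abs k)) _.
  rewrite big_split /= sum_inv_pronic; apply: lerD (S_ge n).
  by rewrite gerBl invr_ge0 ler0n.
have -> : u = (fun n => u 0%N + series (telescope u) n).
  by apply/funext => n; exact: eq_sum_telescope.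
by apply: is_cvgD => //; exact: is_cvg_cst.
Qed.

(** The factors (n+L)/L and its inverse tend to 1 and c/L tends to 0. Sequences are shifted past
    index 0 to keep the denominators nonzero. *)
Lemma cvg_shifted_ratio u l (c : R) n :
  ((fun L => (u (n + L)%N - c) / L%:R) @ \oo --> l)
  <-> ((fun N => u N / N%:R) @ \oo --> l).
Proof.
have h0 : (harmonic : nat -> R) @ \oo --> (0 : R) by exact: cvg_harmonic.
have hn : (fun L => harmonic (L + n)%N : R) @ \oo --> (0 : R).
  by rewrite (cvg_shiftn n (harmonic : nat -> R)).
have nz k : k.+1%:R != 0 :> R by rewrite pnatr_eq0.
split => H.
- rewrite -(cvg_shiftn n.+1) /=.
  have : (fun L => (u (n + L.+1)%N - c) / L.+1%:R * (1 - n%:R * harmonic (L + n)%N)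
      + c * harmonic (L + n)%N) @ \oo --> (l * (1 - n%:R * 0) + c * 0).
    apply: cvgD; last by apply: cvgM => //; exact: cvg_cst.
    apply: cvgM; first by move: H; rewrite -cvg_shiftS.
    by apply: cvgB; [exact: cvg_cst|apply: cvgM => //; exact: cvg_cst].
  rewrite !mulr0 subr0 mulr1 addr0; apply: eq_cvgn => L.
  rewrite /harmonic /= (_ : (L + n.+1 = n + L.+1)%N); last by lia.
  have := nz (L + n)%N; have := nz L; rewrite -!natr1 !natrD -!natr1 => a b.
  by field; rewrite ?a ?andbT /=; apply: contra_neq b => <-; ring.
- rewrite -cvg_shiftS /=.
  have : (fun L => u (L + n.+1)%N / (L + n.+1)%N%:R * (1 + n%:R * harmonic L)
      - c * harmonic L) @ \oo --> (l * (1 + n%:R * 0) - c * 0).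
    apply: cvgB; last by apply: cvgM => //; exact: cvg_cst.
    apply: cvgM; first by move: H; rewrite -(cvg_shiftn n.+1).
    by apply: cvgD; [exact: cvg_cst|apply: cvgM => //; exact: cvg_cst].
  rewrite !mulr0 subr0 addr0 mulr1; apply: eq_cvgn => L.
  rewrite /harmonic /= (_ : (L + n.+1 = n + L.+1)%N); last by lia.
  have := nz (L + n)%N; have := nz L; rewrite -!natr1 !natrD -!natr1 => a b.
  by field; rewrite ?a ?andbT /=; apply: contra_neq b => <-; ring.
Qed.

(** Each factor u_L/L - i/L tends to l; this passes from factorial moments to powers of the
    limit. *)
Lemma cvg_falling_ratio u l a : (fun L => u L / L%:R) @ \oo --> l ->
  (fun L => falling (u L) a / L%:R ^+ a) @ \oo --> l ^+ a.
Proof.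
move=> ul; elim: a => [|a IH].
  have -> : (fun L => falling (u L) 0 / L%:R ^+ 0) = (fun=> 1 : R).
    by apply/funext => L; rewrite falling0 expr0 divr1.
  exact: cvg_cst.
have inv0 : (fun L => L%:R^-1 : R) @ \oo --> (0 : R).
  by rewrite -cvg_shiftS; exact: cvg_harmonic.
have : (fun L => (falling (u L) a / L%:R ^+ a) * (u L / L%:R - a%:R * L%:R^-1)) @ \oo
    --> l ^+ a * (l - a%:R * 0).
  by apply: cvgM => //; apply: cvgB => //; apply: cvgM => //; exact: cvg_cst.
rewrite mulr0 subr0 -exprSr; apply: eq_cvgn => L.
by rewrite fallingS exprSr invfM -mulrBl mulrACA.
Qed.

End Convergence.

(** * Measurability of a pointwise limit with a default value *)

Section MeasurableLimit.

Context d (T : measurableType d) (R : realType).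
Variable u : nat -> T -> R.
Hypothesis mu_ : forall n, measurable_fun setT (u n).

(** The Cauchy criterion in countable form, which makes the set of convergence measurable. *)
Let cauchy_set : set T :=
  \bigcap_(e in [set: nat]) \bigcup_(N in [set: nat])
    \bigcap_(p in [set: nat]) [set w | `|u N w - u (N + p)%N w| <= e.+1%:R^-1].

Let cvg_setE : [set w | cvgn (u ^~ w)] = cauchy_set.
Proof.
apply/seteqP; split=> w /=.
  move=> /cvg_ex[l /cvgrPdist_le ul] e _.
  have e0 : 0 < e.+1%:R^-1 / 2 :> R by rewrite divr_gt0 // invr_gt0.
  have [N _ NP] := ul _ e0; exists N => // p _ /=.
  have := NP N (leqnn N); have := NP (N + p)%N (leq_addr _ _) => /= h1 h2.
  rewrite [leRHS]splitr; apply: le_trans (ler_distD l _ _) _.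
  by rewrite distrC lerD.
move=> H; apply: cauchy_cvg; apply/cauchy_exP => e e0.
have [k ke] : exists k, k.+1%:R^-1 < e.
  have [k _ kP] := (cvgr0_norm_lt _ (@cvg_harmonic R)) e e0.
  by exists k; have := kP k (leqnn k); rewrite /= ger0_norm // invr_ge0.
have [N _ NP] := H k I; exists (u N w).
exists N => // q /= Nq; rewrite /ball /=; apply: le_lt_trans ke.
by have := NP (q - N)%N I; rewrite /= subnKC.
Qed.

(** The function is a genuine limit on the set of convergence and the constant [point] off it; the
    two pieces are glued along a measurable set. *)
Lemma measurable_fun_limn : measurable_fun setT (fun w => limn (u ^~ w)).
Proof.
have mC : measurable [set w | cvgn (u ^~ w)].
  rewrite cvg_setE; apply: bigcapT_measurable => e; apply: bigcupT_measurable => N.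
  apply: bigcapT_measurable => p; rewrite -[X in measurable X]setTI.
  apply: (@measurable_fun_le _ _ _ setT (fun w => `|u N w - u (N + p)%N w|)
    (fun=> e.+1%:R^-1)) => //.
  by apply: measurableT_comp => //; apply: measurable_funB; exact: mu_.
rewrite -(setUv [set w | cvgn (u ^~ w)]); apply/measurable_funU => //.
  exact: measurableC.
split.
  apply: (measurable_fun_cvg (h := u)) => [n|w] //.
  exact: measurable_funS (mu_ n).
apply: (eq_measurable_fun (fun=> point : R)); last exact: measurable_cst.
by move=> w; rewrite inE => nc; rewrite dvgP.
Qed.

End MeasurableLimit.

(** * Almost sure limits of class frequencies and their moments *)

Section LimitMoments.

Context d (T : measurableType d) (R : realType) (P : probability T R).
Variables (alpha : R) (V : nat -> nat -> R) (Pi : nat -> T -> seq {fset nat}).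
Hypothesis alpha1 : alpha <= 1.
Hypothesis gV : gibbs_coefficients alpha V.
Hypothesis hPi : EGP P alpha V Pi.
Implicit Types (s c : seq {fset nat}) (w : T) (n m : nat) (J : pred nat).

Lemma bounded_frequency j : bounded_mfun (frequency R Pi j).
Proof.
pose u N w : R := #|` nth_class (Pi N w) j|%:R / N%:R.
have u01 N w : 0 <= u N w <= 1.
  rewrite /u; apply/andP; split; first by rewrite divr_ge0 ?ler0n.
  have [->|N0] := posnP N; first by rewrite invr0 mulr0.
  rewrite ler_pdivrMr ?ltr0n // mul1r ler_nat.
  (* One class is a mass with a single selected index; [j.-1] matches the numbering of [nth_class],
     also for j = 0. *)
  have := @mass_le N j.-1.+1 (pred1 j.-1) _ (reachable_Pi hPi N w).
  by rewrite /mass (big_pred1 ord_max).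
split.
  apply: (@measurable_fun_limn _ _ _ u) => N.
  exact: (measurable_fun_Pi hPi (fun s => #|` nth_class s j|%:R / N%:R)).
(* The bound has to hold everywhere, so it also covers the default value where the limit fails to
   exist. *)
exists (1 + `|point : R|) => w; rewrite /frequency -/(u ^~ w).
have [cu|/dvgP ->] := pselect (cvgn (u ^~ w)); last by rewrite lerDr.
rewrite (le_trans _ (_ : 1 <= _)) ?lerDl // ger0_norm.
  by apply: limr_le => //; near=> N; case/andP: (u01 N w).
by apply: limr_ge => //; near=> N; case/andP: (u01 N w).
Unshelve. all: by end_near.
Qed.

Lemma size_Pi_homo n L w : (size (Pi n w) <= size (Pi (n + L) w))%N.
Proof.
elim: L => [|L IH]; first by rewrite addn0.
by rewrite addnS (leq_trans IH) // (size_child (Pi_child hPi _ w)).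
Qed.

Lemma incrementS_bound m J n s L w : state Pi n s w -> (m <= size s)%N ->
  increment R Pi m J n s L w <= increment R Pi m J n s L.+1 w
  <= increment R Pi m J n s L w + 1.
Proof.
move=> ws ms; have ms' : (m <= size (Pi (n + L) w))%N.
  by rewrite (leq_trans ms) // -ws size_Pi_homo.
have := mass_le_child J (reachable_Pi hPi _ w) ms' (Pi_child hPi (n + L) w).
rewrite /increment addnS -!(ler_nat R) -natr1 => /andP[? ?].
by apply/andP; split; lra.
Qed.

Lemma increment0 m J n s w : state Pi n s w -> increment R Pi m J n s 0 w = 0.
Proof. by rewrite /state /= /increment addn0 => ->; rewrite subrr. Qed.

Lemma increment_bound m J n s L w : state Pi n s w -> (m <= size s)%N ->
  0 <= increment R Pi m J n s L w <= L%:R.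
Proof.
move=> ws ms; elim: L => [|L /andP[IH1 IH2]]; first by rewrite increment0 // lexx.
have /andP[h1 h2] := incrementS_bound J L ws ms.
by rewrite (le_trans IH1) //= -natr1; lra.
Qed.

(** The weighted sum of squared increments along the cubes has finite integral, hence is finite
    almost everywhere on the state event. That yields convergence along the cubes, then along all L,
    then for the unshifted ratio. *)
Lemma mass_ratio_cvg_ae m J n s : reachable n s -> (0 < n)%N -> (m <= size s)%N ->
  {ae P, forall w, state Pi n s w ->
    cvgn (fun N => (mass m J (Pi N w))%:R / N%:R : R)}.
Proof.
move=> r n0 ms; have mS := measurable_state hPi n s.
pose L k := (k.+1 ^ 3)%N.
pose u k w : R := increment R Pi m J n s (L k) w / (L k)%:R.
pose g k w := (u k w - u k.+1 w) ^+ 2 * (k.+1%:R * k.+2%:R).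
have bg k : bounded_mfun (g k).
  apply: bounded_mfunM; last exact: bounded_mfun_cst.
  apply: bounded_mfunX; apply: bounded_mfunB; apply: bounded_mfunM;
    by [exact: bounded_mfun_cst|exact: bounded_increment hPi _ _ _ _ _].
have g0 k w : (0 <= (g k w)%:E)%E by rewrite lee_fin mulr_ge0 ?sqr_ge0 // mulr_ge0.
pose q := gibbs_moment alpha V m J n s 1 - gibbs_moment alpha V m J n s 2.
(* With a = k + 1, a (a+1) (1/a^3 - 1/(a+1)^3) = (3a^2 + 3a + 1) / (a^2 (a+1)^2), at most 6 / (a
   (a+1)). The absolute value of q avoids a discussion of its sign. *)
have intg k : (\int[P]_(w in state Pi n s) (g k w)%:E
    <= (6 * `|q| * (k.+1%:R * k.+2%:R)^-1)%:E)%E.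
  rewrite integral_bounded_mfunE // lee_fin.
  rewrite (@eq_Rintegral _ _ _ _ _ (fun w => (k.+1%:R * k.+2%:R) * (u k w - u k.+1 w) ^+ 2));
    last by move=> w _; rewrite /g mulrC.
  rewrite Rintegral_bounded_mfunZ //; last first.
    apply: bounded_mfunX; apply: bounded_mfunB; apply: bounded_mfunM;
      by [exact: bounded_mfun_cst|exact: bounded_increment hPi _ _ _ _ _].
  have L0 : (0 < L k)%N by rewrite expn_gt0.
  have LL : (L k <= L k.+1)%N by rewrite leq_exp2r.
  rewrite (mean_increment_variance alpha1 gV hPi _ r n0 ms L0 LL).
  rewrite -/q /L !natrX -[k.+2%:R]natr1; set a := k.+1%:R.
  have a1 : 1 <= a :> R by rewrite ler1n.
  have -> : a * (a + 1) * (q * ((a ^+ 3)^-1 - ((a + 1) ^+ 3)^-1))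
      = q * ((3 * a ^+ 2 + 3 * a + 1) / (a ^+ 2 * (a + 1) ^+ 2)).
    by field; rewrite !gt_eqF //; lra.
  have -> : 6 * `|q| * (a * (a + 1))^-1
      = `|q| * (6 * (a * (a + 1)) / (a ^+ 2 * (a + 1) ^+ 2)).
    by field; rewrite !gt_eqF //; lra.
  have d0 : 0 < a ^+ 2 * (a + 1) ^+ 2 by rewrite mulr_gt0 ?exprn_gt0 //; lra.
  apply: (@le_trans _ _ (`|q| * ((3 * a ^+ 2 + 3 * a + 1) / (a ^+ 2 * (a + 1) ^+ 2)))).
    by apply: ler_wpM2r (ler_norm q); rewrite divr_ge0 ?(ltW d0) //; nra.
  by apply: ler_wpM2l => //; rewrite ler_pM2r ?invr_gt0 //; nra.
pose F w := (\sum_(0 <= k <oo) (g k w)%:E)%E.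
have mg k : measurable_fun (state Pi n s) (fun w => (g k w)%:E).
  by apply/measurable_EFinP; apply: measurable_funTS; case: (bg k).
have F0 w : (0 <= F w)%E by apply: nneseries_ge0 => k _ _; exact: g0.
have iF : P.-integrable (state Pi n s) F.
  apply/integrableP; split.
    apply: (emeasurable_fun_cvg (fun N w => \sum_(0 <= k < N) (g k w)%:E)%E).
      by move=> N; apply: emeasurable_sum.
    by move=> w _; apply: is_cvg_nneseries => k _ _; exact: g0.
  under eq_integral => w _ do rewrite gee0_abs //.
  (* The integral of F is at most 6|q|, as the sums of 1/((k+1)(k+2)) stay below 1. *)
  rewrite integral_nneseries //; apply: le_lt_trans (ltry (6 * `|q|)).
  apply: lime_le; first by apply: is_cvg_nneseries => k _ _; apply: integral_ge0.
  near=> N; apply: le_trans (lee_sum _ (fun k _ => intg k)) _.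
  rewrite sumEFin lee_fin -mulr_sumr sum_inv_pronic ler_piMr ?mulr_ge0 //.
move: (integrable_ae mS iF); apply: filterS => w H ws.
have /is_cvg_summable_increments/cvg_ex[l ul] := H ws.
apply/cvg_ex; exists l.
apply/(cvg_shifted_ratio (fun N => (mass m J (Pi N w))%:R) l (mass m J s)%:R n).
apply: (cvg_along_cubes (u := fun L => increment R Pi m J n s L w)) => //.
- apply/nondecreasing_seqP => k; by case/andP: (incrementS_bound J k ws ms).
- by rewrite increment0.
Unshelve. all: by end_near.
Qed.

Definition frequency_mass m J w : R := \sum_(j < m | J j) frequency R Pi j.+1 w.

Lemma bounded_frequency_mass m J : bounded_mfun (frequency_mass m J).
Proof. by apply: bounded_mfun_sum => j; exact: bounded_frequency. Qed.

(** Convergence is first obtained for each single class, so that every [frequency] involved is a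
    true limit; the finitely many limits are then added. *)
Lemma mass_ratio_cvg_frequency m J n s :
  reachable n s -> (0 < n)%N -> (m <= size s)%N ->
  {ae P, forall w, state Pi n s w ->
    (fun N => (mass m J (Pi N w))%:R / N%:R : R) @ \oo --> frequency_mass m J w}.
Proof.
move=> r n0 ms.
have : \forall w \ae P, forall j : 'I_m, state Pi n s w ->
    cvgn (fun N => (mass m (pred1 (j : nat)) (Pi N w))%:R / N%:R : R).
  by apply: filter_forall => j; exact: mass_ratio_cvg_ae.
apply: filterS => w H ws.
have -> : (fun N => (mass m J (Pi N w))%:R / N%:R : R)
    = (fun N => \sum_(j < m | J j) (#|` nth_class (Pi N w) j.+1|%:R / N%:R)).
  by apply/funext => N; rewrite /mass natr_sum mulr_suml.
apply: cvg_big => [|j _]; first exact: add_continuous.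
have := H j ws.
have -> // : (fun N => (mass m (pred1 (j : nat)) (Pi N w))%:R / N%:R : R)
    = (fun N => #|` nth_class (Pi N w) j.+1|%:R / N%:R).
by apply/funext => N; rewrite /mass (big_pred1 j).
Qed.

Lemma Rintegral_frequency_mass m J n s a :
  reachable n s -> (0 < n)%N -> (m <= size s)%N ->
  \int[P]_(w in state Pi n s) frequency_mass m J w ^+ a
  = gibbs_moment alpha V m J n s a.
Proof.
move=> r n0 ms; have mS := measurable_state hPi n s.
pose f L w : R := falling (increment R Pi m J n s L.+1 w) a / L.+1%:R ^+ a.
have bf L : bounded_mfun (f L).
  apply: bounded_mfunM; last exact: bounded_mfun_cst.
  by apply: bounded_falling; exact: bounded_increment hPi _ _ _ _ _.
have bX := bounded_mfunX a (bounded_frequency_mass m J).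
have fE L : \int[P]_(w in state Pi n s) f L w
    = falling L.+1%:R a / L.+1%:R ^+ a * gibbs_moment alpha V m J n s a.
  rewrite mulrAC -(falling_moment alpha1 gV hPi) // [RHS]mulrC -Rintegral_bounded_mfunZ //.
    by apply: eq_Rintegral => w _; rewrite mulrC.
  by apply: bounded_falling; exact: bounded_increment hPi _ _ _ _ _.
(* Each of the a factors is at most max(L+1, a) in absolute value, hence at most (1+a)(L+1). This is
   the dominating constant. *)
have fb L w : state Pi n s w -> `|f L w| <= (1 + a%:R) ^+ a.
  move=> ws; rewrite normrM [X in _ * X <= _]ger0_norm ?invr_ge0 ?exprn_ge0 //.
  rewrite ler_pdivrMr ?exprn_gt0 //.
  have /andP[i0 iL] := increment_bound J L.+1 ws ms.
  rewrite -exprMn /falling normr_prod -[a in _ ^+ a]card_ord -prodr_const.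
  apply: ler_prod => i _; rewrite normr_ge0 /=.
  have ia : i%:R <= a%:R :> R by rewrite ler_nat ltnW.
  have L1 : 1 <= L.+1%:R :> R by rewrite ler1n.
  have i00 : 0 <= i%:R :> R by [].
  rewrite ler_norml; apply/andP; split; nra.
have mf : measurable_fun (state Pi n s) (fun w => (frequency_mass m J w ^+ a)%:E).
  by apply/measurable_EFinP; apply: measurable_funTS; case: bX.
have fX : {ae P, forall w, state Pi n s w ->
    (fun L => (f L w)%:E) @ \oo --> (frequency_mass m J w ^+ a)%:E}.
  apply: filterS (mass_ratio_cvg_frequency J r n0 ms) => w H ws.
  apply: cvg_EFin; first by near=> L.
  have /cvg_falling_ratio := (cvg_shifted_ratio _ _ (mass m J s)%:R n).2 (H ws).
  by move=> /(_ a); rewrite -cvg_shiftS.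
have [|||_ _] := @dominated_convergence _ _ _ P _ mS (fun L w => (f L w)%:E)
  (fun w => (frequency_mass m J w ^+ a)%:E) (cst ((1 + a%:R) ^+ a)%:E) _ mf fX.
- by move=> L; apply/measurable_EFinP; apply: measurable_funTS; case: (bf L).
- rewrite -[cst _]/(EFin \o (fun=> (1 + a%:R) ^+ a)).
  by apply: bounded_mfun_integrable => //; exact: bounded_mfun_cst.
- by apply: aeW => w L ws; rewrite lee_fin; exact: fb.
rewrite integral_bounded_mfunE // => cvg1.
(* The same integrals also tend to the Gibbs moment, because the falling factorial of L divided by
   L^a tends to 1. *)
apply: EFin_inj; apply: (cvg_unique (@ereal_hausdorff R) cvg1).
apply: cvg_EFin; first by near=> L; rewrite /= integral_bounded_mfunE.
have -> : fine \o (fun L => \int[P]_(w in state Pi n s) (f L w)%:E)%E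
    = (fun L => falling L.+1%:R a / L.+1%:R ^+ a * gibbs_moment alpha V m J n s a).
  by apply/funext => L; rewrite /= -fE.
rewrite -[X in _ --> X]mul1r -[in X in _ --> X](expr1n R a).
apply: cvgM; last exact: cvg_cst.
have : (fun L => falling L%:R a / L%:R ^+ a : R) @ \oo --> (1 : R) ^+ a.
  apply: cvg_falling_ratio; rewrite -cvg_shiftS.
  by apply: (@eq_cvgn _ (fun=> 1)) => [L|]; [rewrite /= divff // pnatr_eq0|exact: cvg_cst].
by rewrite -cvg_shiftS.
Unshelve. all: by end_near.
Qed.

End LimitMoments.

(** * Conditioning on the record index *)

Section RecordIndex.

Context d (T : measurableType d) (R : realType) (P : probability T R).
Variables (alpha : R) (V : nat -> nat -> R) (Pi : nat -> T -> seq {fset nat}).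
Hypothesis alpha1 : alpha <= 1.
Hypothesis gV : gibbs_coefficients alpha V.
Hypothesis hPi : EGP P alpha V Pi.
Variables (m i : nat).
Hypothesis m0 : (0 < m)%N.
Implicit Types (s c : seq {fset nat}) (w : T) (n : nat) (J : pred nat).

Lemma mem_nth_Pi N l w k : (l <= N)%N ->
  (l \in nth fset0 (Pi N w) k) = (l \in nth fset0 (Pi l w) k).
Proof.
elim: N => [|N IH]; first by rewrite leqn0 => /eqP ->.
rewrite leq_eqVlt => /orP[/eqP <- //|]; rewrite ltnS => lN.
by rewrite (mem_nth_child _ (Pi_child hPi N w)) ?IH //; lia.
Qed.

Lemma mem_nth_Pi_bound N l w k : l \in nth fset0 (Pi N w) k -> (0 < l <= N)%N.
Proof.
have r := reachable_Pi hPi N w.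
have [ks|ks] := ltnP k (size (Pi N w)); last by rewrite nth_default.
by have [_ /fsubsetP sub] := reachable_class r (mem_nth fset0 ks);
  move=> /sub; rewrite integers_uptoE.
Qed.

Definition record_state s : bool :=
  (size s == m) && (nth fset0 s m.-1 == [fset i]%fset).

(** If i had joined an existing class, that class would contain an earlier element, so i opens class
    m. Conversely, an element of class m below i would already be in it at time i. *)
Lemma record_index_eventE :
  record_index_event Pi m i = [set w | record_state (Pi i w)].
Proof.
apply/seteqP; split=> w; rewrite /record_index_event /record_state /=.
  move=> [[N _ /= iN] imin].
  have /andP[i0 iN'] := mem_nth_Pi_bound iN.
  move: iN; rewrite /nth_class mem_nth_Pi // => ii.
  have old k l : (l < k)%N -> l \in nth fset0 (Pi k w) m.-1 -> (i <= l)%N.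
    by move=> lk lw; apply: imin; exists k.
  case: i i0 ii old => // i' _ ii old; have r := reachable_Pi hPi i' w.
  have /childrenP[E|[j js E]] := Pi_child hPi i' w.
    move: ii; rewrite E nth_new_class size_new_class; case: eqVneq => [<- _|_].
      by rewrite prednK // !eqxx.
    by rewrite (negbTE (reachable_notin _ r)).
  have ii' := ii; move: ii; rewrite E nth_join_class; case: eqVneq => [mj _|_]; last first.
    by rewrite (negbTE (reachable_notin _ r)).
  have := reachable_card_gt0 r js; rewrite cardfs_gt0 => /fset0Pn[y yj].
  have /andP[_ yi] := mem_nth_Pi_bound yj.
  have := old i'.+1 y; rewrite ltnS yi E nth_join_class mj eqxx inE yj orbT.
  by move=> /(_ isT isT); lia.
move=> /andP[_ /eqP E]; split; first by exists i => //=; rewrite /nth_class E inE.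
move=> l [N _ /= lN]; rewrite leqNgt; apply/negP => li.
have /andP[_ lN'] := mem_nth_Pi_bound lN.
have : l \in nth fset0 (Pi i w) m.-1.
  by rewrite mem_nth_Pi ?(ltnW li) // -(mem_nth_Pi w _ lN').
by rewrite E inE => /eqP E'; move: li; rewrite E' ltnn.
Qed.

Lemma measurable_record_index_event : measurable (record_index_event Pi m i).
Proof.
rewrite record_index_eventE.
have := measurable_fun_Pi hPi (fun s => (record_state s)%:R) i measurableT
  (measurable_set1 (1 : R)).
rewrite setTI; congr (measurable _); apply/seteqP; split=> w /=.
  by case: record_state => // /eqP; rewrite eq_sym oner_eq0.
by move=> ->.
Qed.

Section FixedClasses.

Variables (J : pred nat) (y0 : R).
Hypothesis y0E : forall s, reachable i s -> record_state s ->
  discounted_mass alpha m J s = y0.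

Let X := frequency_mass R Pi m J.
Let E := record_index_event Pi m i.

(* Given i_m = i, the state of Pi i is still random, but the moment of X given
   that state depends on (i, m) only. *)
Lemma Rintegral_record_zero a (x y : R) :
  x * (rising y0 a * V (i + a)%N m) + y * V i m = 0 ->
  \int[P]_(w in E) (x * X w ^+ a + y) = 0.
Proof.
move=> xy0; pose f w := x * X w ^+ a + y.
have bXa : bounded_mfun (fun w => X w ^+ a).
  by apply: bounded_mfunX; exact: bounded_frequency_mass hPi _ _.
have bxX : bounded_mfun (fun w => x * X w ^+ a).
  by apply: bounded_mfunM => //; exact: bounded_mfun_cst.
have bf : bounded_mfun f by apply: bounded_mfunD => //; exact: bounded_mfun_cst.
have mE := measurable_record_index_event.
(* L counts the steps left until time i, starting from the empty partition. A vanishing integral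
   passes from children to parent, so the total weight of the record states is never computed. *)
suff H L n s : (n + L)%N = i -> reachable n s -> \int[P]_(w in state Pi n s `&` E) f w = 0.
  rewrite -(H i 0%N [::]) //; last exact: reachable_nil.
  have -> : state Pi 0 [::] = setT.
    apply/seteqP; split=> // w _; have := reachable_size (reachable_Pi hPi 0 w).
    by rewrite leqn0 => /nilP.
  by rewrite setTI.
elim: L n s => [|L IH] n s; last first.
  move=> nL r; rewrite (Rintegral_state hPi bf mE r) big_seq big1 // => c cs.
  by apply: IH; [rewrite addSn -addnS|exact: reachable_child cs].
rewrite addn0 => -> r; have [rs|nrs] := boolP (record_state s); last first.
  have -> : state Pi i s `&` E = set0.
    rewrite /E record_index_eventE -subset0 => w [/= ws rs].
    by move: nrs; rewrite -ws rs.
  exact: Rintegral_set0.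
have -> : state Pi i s `&` E = state Pi i s.
  by apply: setIidl => w sw; rewrite /E record_index_eventE /= sw.
have mS := measurable_state hPi i s.
have sm : size s = m by case/andP: rs => /eqP.
have i0 : (0 < i)%N by rewrite (leq_trans m0) // -sm reachable_size.
rewrite /f Rintegral_bounded_mfunD //; last exact: bounded_mfun_cst.
rewrite Rintegral_bounded_mfunZ // (Rintegral_cst_state alpha1 gV hPi) //.
rewrite (Rintegral_frequency_mass alpha1 gV hPi) ?sm // /gibbs_moment y0E // sm.
transitivity ((x * (rising y0 a * V (i + a)%N m) + y * V i m) * weight alpha s).
  by ring.
by rewrite xy0 mul0r.
Qed.

Lemma cond_expectation_frequency_mass a : (0 < P E)%E ->
  cond_expectation P (fun w => X w ^+ a) E
  = (rising y0 a * (V (i + a)%N m / V i m))%:E.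
Proof.
move=> PE0; have mE := measurable_record_index_event.
have bXa : bounded_mfun (fun w => X w ^+ a).
  by apply: bounded_mfunX; exact: bounded_frequency_mass hPi _ _.
have PEfin : P E \is a fin_num by exact: fin_num_measure.
pose p := fine (P E); have PE : P E = p%:E by rewrite fineK.
have p0 : 0 < p by rewrite -lte_fin -PE.
have combine x y : x * (rising y0 a * V (i + a)%N m) + y * V i m = 0 ->
    x * \int[P]_(w in E) X w ^+ a + y * p = 0.
  move=> /Rintegral_record_zero <-; rewrite Rintegral_bounded_mfunD //.
  - by rewrite Rintegral_bounded_mfunZ // Rintegral_cst.
  - by apply: bounded_mfunM => //; exact: bounded_mfun_cst.
  - exact: bounded_mfun_cst.
(* With x = 0 and y = 1, a vanishing coefficient would make the record event null. *)
have V0 : V i m != 0.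
  apply/eqP => V0; have := combine 0 1; rewrite V0 mul0r mulr0 addr0 => /(_ erefl).
  by rewrite mul0r mul1r add0r => /eqP; rewrite gt_eqF.
rewrite /cond_expectation integral_bounded_mfunE // PE inver gt_eqF // -EFinM.
(* This choice of x and y satisfies the linear relation identically and identifies the moment up to
   the nonzero factor [V i m]. *)
congr EFin; have := combine (V i m) (- (rising y0 a * V (i + a)%N m)).
have -> : forall u v : R, u * v + - v * u = 0 by move=> u v; ring.
move=> /(_ erefl) /eqP; rewrite mulNr subr_eq0 => /eqP H.
by apply: (mulfI V0); rewrite [LHS]mulrA H; field; rewrite ?V0 gt_eqF.
Qed.

End FixedClasses.

End RecordIndex.

Theorem lemma4 (d : measure_display) (T : measurableType d) (R : realType)
    (P : probability T R) (alpha : R) (V : nat -> nat -> R)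
    (Pi : nat -> T -> seq {fset nat})
    (halpha : alpha <= 1) (hV : gibbs_coefficients alpha V)
    (hPi : EGP P alpha V Pi)
    (m n i : nat) (hm : (0 < m)%N)
    (hi : (0 < P (record_index_event Pi m i))%E) :
  cond_expectation P (fun w => cumulative_frequency R Pi m w ^+ n)
    (record_index_event Pi m i)
  = (rising (i%:R - alpha * m%:R) n * (V (i + n)%N m / V i m))%:E
  /\
  cond_expectation P (fun w => frequency R Pi m w ^+ n)
    (record_index_event Pi m i)
  = (rising (1 - alpha) n * (V (i + n)%N m / V i m))%:E.
Proof.
split.
- rewrite -(cond_expectation_frequency_mass halpha hV hPi hm (J := xpredT)) //.
    congr cond_expectation; apply/funext => w.
    by rewrite /cumulative_frequency big_add1 big_mkord.
  (* At time i all m classes are selected and their sizes add up to i. *)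
  move=> s r /andP[/eqP <- _]; exact: sum_discounted.
- rewrite -(cond_expectation_frequency_mass halpha hV hPi hm (J := pred1 m.-1)) //.
    congr cond_expectation; apply/funext => w.
    have mm : (m.-1 < m)%N by rewrite prednK.
    by rewrite /frequency_mass (big_pred1 (Ordinal mm)) //= prednK.
  (* The selected class has index m - 1 when counted from 0, and at time i it is the singleton
     {i}. *)
  move=> s r /andP[_ /eqP E]; have mm : (m.-1 < m)%N by rewrite prednK.
  by rewrite /discounted_mass (big_pred1 (Ordinal mm)) //= E cardfs1.
Qed.
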